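(* Let $K$ be an imaginary quadratic field of class number $1$, let $E/K$ be an elliptic curve, and let $p$ be an odd prime that splits in $K$, $pO_K=\mathfrak{p}_1\mathfrak{p}_2$, such that $E$ has good ordinary reduction at $\mathfrak{p}_1$ and $\mathfrak{p}_2$. Let $P=(x,y)\in E(K)_{\mathrm{ht}}$ be a non-torsion point. Put $t=-x/y$, $t_i=\psi_i(t)$ for $i=1,2$, let $\sigma_1,\sigma_2$ be the $p$-adic sigma functions of $E_{K_{\mathfrak{p}_1}}$ and $E_{K_{\mathfrak{p}_2}}$, and let $d=d(P)\in O_K$ be the denominator of $P$. Then the anticyclotomic $p$-adic height of $P$ is given by $$h^{\mathrm{anti}}(P)=\log_p\!\left(\frac{\sigma_1(t_1)}{\sigma_2(t_2)}\right)-\log_p\!\left(\frac{\psi_1(d)}{\psi_2(d)}\right).$$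
   Context: Notation. $O_K$ is the ring of integers of $K$; for a finite place $v$, $K_v$ is the completion, $O_v$ its ring of integers, $\pi_v$ a uniformiser, $\mathrm{val}_v$ the normalized valuation. $\psi_1,\psi_2:K\hookrightarrow\mathbb{Q}_p$ are the two embeddings, and $\psi_i$ also denotes the induced isomorphism $K_{\mathfrak{p}_i}\to\mathbb{Q}_p$. $\log_p$ is the Iwasawa branch of the $p$-adic logarithm ($\log_p(p)=0$). $E$ is given by a global minimal Weierstrass equation over $O_K$ with coefficients $a_1,a_2,a_3,a_4,a_6$ (it exists as $K$ has class number $1$), and $\mathcal{E}$ denotes the corresponding model. Anticyclotomic character. An id\`ele class character is a continuous homomorphism $\chi=\sum_v\chi_v:\mathbb{A}_K^\times/K^\times\to\mathbb{Q}_p$, where $\chi_v$ is the restriction of $\chi$ to $K_v^\times$. The anticyclotomic character $\chi^{\mathrm{anti}}$ is normalized as $$\chi^{\mathrm{anti}}\big((x_v)_v\big)=\log_p\big(\psi_1(\alpha)\,\psi_1(x_{\mathfrak{p}_1})\big)-\log_p\big(\psi_2(\alpha)\,\psi_2(x_{\mathfrak{p}_2})\big),$$ where $\alpha\in K^\times$ is any element with $\alpha x_v\in O_v^\times$ for all finite $v$ (such $\alpha$ exists because the class number is $1$, and the value does not depend on the choice). $p$-adic sigma function. For $i=1,2$, let $\omega=dx/(2y+a_1x+a_3)$ be the invariant differential of $E_{K_{\mathfrak{p}_i}}$ (viewed over $\mathbb{Q}_p$ via $\psi_i$), and let $x(t)=t^{-2}+\cdots\in\mathbb{Z}_p((t))$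 be the expansion of $x$ in the parameter $t=-x/y$ at infinity. Then $\sigma_i(t)=t+\cdots\in t\mathbb{Z}_p[[t]]$ is the unique odd function (odd with respect to inversion in the formal group) for which there is a constant $c\in\mathbb{Z}_p$ with $$x(t)+c=-\frac{d}{\omega}\left(\frac{1}{\sigma_i}\frac{d\sigma_i}{\omega}\right).$$ For a point $R$ in the kernel of reduction $E^1_{\mathfrak{p}_i}=\ker(\mathcal{E}(K_{\mathfrak{p}_i})\to\mathcal{E}(O_K/\mathfrak{p}_i))$ we write $\sigma_{\mathfrak{p}_i}(R)=\sigma_i(t(R))$, where $t(R)=-x(R)/y(R)$, identified with an element of $\mathbb{Q}_p$ via $\psi_i$. The set $E(K)_{\mathrm{ht}}$. This is the set of non-torsion points of $E(K)$ that lie in $E^1_{\mathfrak{p}}$ for both $\mathfrak{p}\mid p$ and reduce to the identity component (i.e. have non-singular reduction on the minimal Weierstrass model) at all finite $v\nmid p$. Denominators. For a point $P=(x,y)$ with non-singular reduction at all finite places, there are $a(P),b(P),d(P)\in O_K$, pairwise coprime, with $x=a(P)/d(P)^2$ and $y=b(P)/d(P)^3$; $d(P)$ is well defined up to a unit of $O_K$. For finite $v\nmid p$ put $\tilde\sigma_v(P)=\pi_v^{\mathrm{val}_v(d(P))}$. Anticyclotomic height. For $P\in E(K)_{\mathrm{ht}}$, with $\chi=\chi^{\mathrm{anti}}$, set $h^{\mathrm{anti}}_{\mathfrak{p}}(P)=\chi_{\mathfrak{p}}(\sigma_{\mathfrak{p}}(P))$ for $\mathfrak{p}\mid p$ (where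 $\sigma_{\mathfrak p_i}(P)$ is regarded as an element of $K_{\mathfrak p_i}^\times$ via $\psi_i^{-1}$) and $h^{\mathrm{anti}}_v(P)=\chi_v(\tilde\sigma_v(P))$ for finite $v\nmid p$, and define $h^{\mathrm{anti}}(P)=\sum_v h_v^{\mathrm{anti}}(P)$, the sum over all finite places $v$ of $K$. *)

(* Defs.v *)
Set Warnings "-notation-overridden,-ambiguous-paths,-overwriting-delimiting-key".
From HB Require Import structures.
From mathcomp Require Import all_boot all_order all_algebra all_field.
From mathcomp Require Import boolp classical_sets functions cardinality fsbigop.
From mathcomp Require Import reals constructive_ereal.
From mathcomp Require Import complex.

Set Implicit Arguments.
Unset Strict Implicit.
Unset Printing Implicit Defensive.

Import Order.TTheory GRing.Theory Num.Theory.

Local Open Scope classical_set_scope.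
Local Open Scope ring_scope.

Definition valuation (K : fieldType) (v : K -> \bar int) : Prop :=
  [/\ forall x, v x = +oo%E <-> x = 0,
      forall x, v x <> -oo%E,
      forall x y, v (x * y) = (v x + v y)%E
    & forall x y, (Order.min (v x) (v y) <= v (x + y)%R)%E].

Lemma valuation1 (K : fieldType) (v : K -> \bar int) : valuation v -> v 1 = 0%E.
Proof.
case=> v0 vN vM _; have := vM 1 1; rewrite mulr1.
have : v 1 <> +oo%E by move/v0/eqP; rewrite oner_eq0.
case: (v 1) (vN 1) => [n| |] // _ _ [] /eqP.
by rewrite -{1}[n]addr0 (inj_eq (addrI _)) => /eqP <-.
Qed.

Section Completion.
Context (L : fieldType) (w : L -> \bar int).

Definition val_cvg (u : nat -> L) (l : L) : Prop :=
  forall N : int, exists n0 : nat, forall n : nat,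
    (n0 <= n)%N -> (N%:E <= w (u n - l)%R)%E.

Definition val_cauchy (u : nat -> L) : Prop :=
  forall N : int, exists n0 : nat, forall m n : nat,
    (n0 <= m)%N -> (n0 <= n)%N -> (N%:E <= w (u m - u n)%R)%E.

(* The limit of u; it is 0 if u diverges. *)
Definition val_lim (u : nat -> L) : L := xget 0 [set l | val_cvg u l].

End Completion.

(* A completion of K at v: a complete valued field in which K is dense; it is
   determined by (K, v) up to a unique isometric K-isomorphism. *)
Structure completion (K : fieldType) (v : K -> \bar int) := Completion {
  cfield :> fieldType;
  cembed : {rmorphism K -> cfield};
  cval : cfield -> \bar int;
  cvalP : valuation cval;
  cval_embed : forall x, cval (cembed x) = v x;
  cembed_dense : forall (y : cfield) (N : int),
    exists x, (N%:E <= cval (y - cembed x)%R)%E;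
  cval_complete : forall u, val_cauchy cval u -> exists l, val_cvg cval u l
}.
Arguments cembed {K v} c.
Arguments cval {K v} c.

Definition padic_val (p : nat) (q : rat) : \bar int :=
  if q == 0 then +oo%E
  else ((logn p `|numq q|%N)%:Z - (logn p `|denq q|%N)%:Z)%:E.

(* log is the unique homomorphism Q_p^* -> Q_p that vanishes at p and is given
   by the usual power series on 1 + p Z_p; its value at 0 is irrelevant. *)
Definition iwasawa_log (p : nat) (Qp : completion (padic_val p))
    (log : Qp -> Qp) : Prop :=
  [/\ forall x y, x != 0 -> y != 0 -> log (x * y) = log x + log y,
      log p%:R = 0
    & forall x, (0 < cval Qp x)%E ->
        val_cvg (cval Qp)
          (fun n => \sum_(1 <= k < n.+1) (-1) ^+ k.+1 * x ^+ k / k%:R)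
          (log (1 + x))].

Definition fps (F : Type) : Type := nat -> F.

Section PowerSeries.
Context (F : fieldType).

HB.instance Definition _ := gen_eqMixin (fps F).
HB.instance Definition _ := gen_choiceMixin (fps F).

Implicit Types f g h : fps F.

Definition fps_add f g : fps F := fun n => f n + g n.
Definition fps_opp f : fps F := fun n => - f n.
Definition fpsC (a : F) : fps F := fun n => if n == 0%N then a else 0.
Definition fps_mul f g : fps F := fun n => \sum_(i < n.+1) f i * g (n - i)%N.

Fact fps_addA : associative fps_add.
Proof. by move=> f g h; apply/funext => n; exact: addrA. Qed.
Fact fps_addC : commutative fps_add.
Proof. by move=> f g; apply/funext => n; exact: addrC. Qed.
Fact fps_add0 : left_id (fpsC 0) fps_add.
Proof. by move=> f; apply/funext => -[|n]; exact: add0r. Qed.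
Fact fps_addN : left_inverse (fpsC 0) fps_opp fps_add.
Proof. by move=> f; apply/funext => -[|n]; exact: addNr. Qed.

HB.instance Definition _ :=
  GRing.isZmodule.Build (fps F) fps_addA fps_addC fps_add0 fps_addN.

Definition fps_trunc (N : nat) f : {poly F} := \poly_(i < N) f i.

Fact fps_trunc_mul N f g n : (n < N)%N ->
  fps_mul f g n = (fps_trunc N f * fps_trunc N g)`_n.
Proof.
move=> nN; rewrite coefM; apply: eq_bigr => i _.
rewrite !coef_poly (leq_ltn_trans (leq_ord i) nN).
by rewrite (leq_ltn_trans (leq_subr _ _) nN).
Qed.

Fact fps_mulC : commutative fps_mul.
Proof.
by move=> f g; apply/funext => n; rewrite !(fps_trunc_mul _ _ (ltnSn n)) mulrC.
Qed.

Fact fps_mulA : associative fps_mul.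
Proof.
move=> f g h; apply/funext => n.
have E N (p q : {poly F}) m : (m < N)%N ->
    (forall k, (k < N)%N -> p`_k = q`_k) -> forall r : {poly F},
    (p * r)`_m = (q * r)`_m.
  move=> mN pq r; rewrite !coefM; apply: eq_bigr => i _.
  by rewrite pq // (leq_ltn_trans (leq_ord i) mN).
have H f' g' h' : fps_mul (fps_mul f' g') h' n =
    (fps_trunc n.+1 f' * fps_trunc n.+1 g' * fps_trunc n.+1 h')`_n.
  rewrite (fps_trunc_mul _ _ (ltnSn n)); apply: (E n.+1) => // k kn.
  by rewrite coef_poly kn; exact: fps_trunc_mul.
by rewrite fps_mulC !H mulrC mulrA.
Qed.

Fact fps_mul1 : left_id (fpsC 1) fps_mul.
Proof.
move=> f; apply/funext => n; rewrite /fps_mul big_ord_recl subn0 mul1r.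
by rewrite big1 ?addr0 // => i _; rewrite mul0r.
Qed.

Fact fps_mulDl : left_distributive fps_mul fps_add.
Proof.
move=> f g h; apply/funext => n; rewrite /fps_add /fps_mul -big_split /=.
by apply: eq_bigr => i _; rewrite mulrDl.
Qed.

Fact fps_1neq0 : fpsC 1 != 0 :> fps F.
Proof.
by apply/eqP => /(congr1 (fun f : fps F => f 0%N)) /eqP; rewrite /= oner_eq0.
Qed.

HB.instance Definition _ := GRing.Zmodule_isComNzRing.Build (fps F)
  fps_mulA fps_mulC fps_mul1 fps_mulDl fps_1neq0.

Definition fps_unit f : bool := `[< exists g, g * f = 1 >].
Definition fps_inv f : fps F :=
  if fps_unit f then xget 0 [set g | g * f = 1] else f.

Fact fps_mulV : {in fps_unit, left_inverse 1 fps_inv *%R}.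
Proof.
move=> f uf; rewrite /fps_inv; have -> : fps_unit f by [].
by move/asboolP: uf; exact: xgetPex.
Qed.
Fact fps_unitP f g : g * f = 1 -> fps_unit f.
Proof. by move=> gf; apply/asboolP; exists g. Qed.
Fact fps_inv_out : {in [predC fps_unit], fps_inv =1 id}.
Proof. by move=> f uf; rewrite /fps_inv ifN. Qed.

HB.instance Definition _ := GRing.ComNzRing_hasMulInverse.Build (fps F)
  fps_mulV fps_unitP fps_inv_out.

Fact fps_idomain : GRing.integral_domain_axiom (fps F).
Proof.
move=> f g fg0; apply/orP.
have low (h : fps F) : h != 0 ->
    exists2 m, h m != 0 & forall k, (k < m)%N -> h k = 0.
  move=> h0; have exh : exists m, h m != 0.
    apply: contrapT => no; move/eqP: h0; apply; apply/funext => k.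
    have -> : (0 : fps F) k = 0 by case: k.
    by apply/eqP; apply: contrapT => /negP hk; apply: no; exists k.
  exists (ex_minn exh); first by case: ex_minnP.
  case: ex_minnP => m _ min k km; apply/eqP; apply: contraTT km => /min.
  by rewrite -leqNgt.
have [_|/low[m fm mf]] := eqVneq f 0; first by left.
have [_|/low[n gn ng]] := eqVneq g 0; first by right.
have := congr1 (fun h : fps F => h (m + n)%N) fg0.
have -> : (0 : fps F) (m + n)%N = 0 by case: (m + n)%N.
have mmn : (m < (m + n).+1)%N by rewrite ltnS leq_addr.
rewrite /GRing.mul /= /fps_mul (bigD1 (Ordinal mmn)) //= big1 ?addr0; last first.
  move=> i /eqP im; have [lt_im|lt_mi|e] := ltngtP i m.
  - by rewrite mf ?mul0r.
  - by rewrite ng ?mulr0 // ltn_subLR ?ltn_add2r // -ltnS ltn_ord.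
  - by case: im; apply/val_inj.
by rewrite addKn => /eqP; rewrite mulf_eq0 (negPf fm) (negPf gn).
Qed.

HB.instance Definition _ :=
  GRing.ComUnitRing_isIntegral.Build (fps F) fps_idomain.

Definition fpsX : fps F := fun n => (n == 1)%N%:R.

Definition fps_deriv f : fps F := fun n => f n.+1 *+ n.+1.

(* The composite f(g(t)), meaningful when g has no constant term. *)
Definition fps_comp f g : fps F := fun n => \sum_(k < n.+1) f k * (g ^+ k) n.

(* The field of Laurent series F((t)). *)
Definition laurent : fieldType := {fraction (fps F)}.

Definition of_fps (f : fps F) : laurent := tofrac f.

(* d/dt, by the quotient rule on a representative a/b (the result does not
   depend on the representative). *)
Definition laurent_deriv (z : laurent) : laurent :=
  let a := \n_(repr z) in let b := \d_(repr z) in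
  of_fps (fps_deriv a * b - a * fps_deriv b) / of_fps (b ^+ 2).

End PowerSeries.
Arguments fpsX {F}.

(* y^2 + a1 x y + a3 y = x^3 + a2 x^2 + a4 x + a6 *)
Record weierstrass (F : Type) := Weierstrass {
  wa1 : F; wa2 : F; wa3 : F; wa4 : F; wa6 : F }.

Definition map_weierstrass (F G : Type) (f : F -> G) (W : weierstrass F) :=
  Weierstrass (f (wa1 W)) (f (wa2 W)) (f (wa3 W)) (f (wa4 W)) (f (wa6 W)).

Inductive point (F : Type) := Infinity | Affine (x y : F).
Arguments Infinity {F}.

Section Weierstrass.
Context (F : fieldType) (W : weierstrass F).
Let a1 := wa1 W.
Let a2 := wa2 W.
Let a3 := wa3 W.
Let a4 := wa4 W.
Let a6 := wa6 W.

Definition discriminant : F :=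
  let b2 := a1 ^+ 2 + 4 * a2 in
  let b4 := 2 * a4 + a1 * a3 in
  let b6 := a3 ^+ 2 + 4 * a6 in
  let b8 := a1 ^+ 2 * a6 + 4 * a2 * a6 - a1 * a3 * a4 + a2 * a3 ^+ 2
            - a4 ^+ 2 in
  - b2 ^+ 2 * b8 - 8 * b4 ^+ 3 - 27 * b6 ^+ 2 + 9 * b2 * b4 * b6.

Definition on_curve (P : point F) : Prop :=
  if P is Affine x y then
    y ^+ 2 + a1 * x * y + a3 * y = x ^+ 3 + a2 * x ^+ 2 + a4 * x + a6
  else True.

Definition ec_add (P Q : point F) : point F :=
  match P, Q with
  | Infinity, _ => Q
  | _, Infinity => P
  | Affine x1 y1, Affine x2 y2 =>
    if (x1 == x2) && (y1 + y2 + a1 * x2 + a3 == 0) then Infinity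
    else
      let l := if x1 == x2
               then (3 * x1 ^+ 2 + 2 * a2 * x1 + a4 - a1 * y1)
                    / (2 * y1 + a1 * x1 + a3)
               else (y2 - y1) / (x2 - x1) in
      let x3 := l ^+ 2 + a1 * l - a2 - x1 - x2 in
      Affine x3 (- (y1 + l * (x3 - x1)) - a1 * x3 - a3)
  end.

Definition ec_mul (n : nat) (P : point F) : point F :=
  iter n (ec_add P) Infinity.

Definition non_torsion (P : point F) : Prop :=
  forall n : nat, (0 < n)%N -> ec_mul n P <> Infinity.

(* The equation in x', y' with x = u^2 x' + r and y = u^3 y' + u^2 s x' + t. *)
Definition change_of_variables (u r s t : F) : weierstrass F :=
  Weierstrass
    ((a1 + 2 * s) / u)
    ((a2 - s * a1 + 3 * r - s ^+ 2) / u ^+ 2)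
    ((a3 + r * a1 + 2 * t) / u ^+ 3)
    ((a4 - s * a3 + 2 * r * a2 - (t + r * s) * a1 + 3 * r ^+ 2 - 2 * s * t)
       / u ^+ 4)
    ((a6 + r * a4 + r ^+ 2 * a2 + r ^+ 3 - t * a3 - t ^+ 2 - r * t * a1)
       / u ^+ 6).

End Weierstrass.

Section Sigma.
Context (F : fieldType) (W : weierstrass F).

Let const (a : F) : laurent F := of_fps (fpsC a).
Let WL : weierstrass (laurent F) := map_weierstrass const W.

(* The expansions of x and y at infinity in the parameter t = - x / y. *)
Definition formal_expansion (x y : laurent F) : Prop :=
  [/\ on_curve WL (Affine x y), of_fps fpsX * y = - x
    & exists2 f : fps F, f 0%N = 1 & x = of_fps f / of_fps fpsX ^+ 2].

(* d/omega for omega = dx / (2 y + a1 x + a3). *)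
Definition deriv_omega (x y z : laurent F) : laurent F :=
  laurent_deriv z
    / (laurent_deriv x / (2 * y + wa1 WL * x + wa3 WL)).

(* i = t(-P) as a power series in t = t(P). *)
Definition formal_inverse (x y : laurent F) (i : fps F) : Prop :=
  of_fps i = - x / (- y - wa1 WL * x - wa3 WL).

Definition is_sigma (integral : F -> Prop) (s : fps F) : Prop :=
  [/\ forall n, integral (s n), s 0%N = 0, s 1%N = 1
    & exists x y : laurent F,
      [/\ formal_expansion x y,
          exists2 i, formal_inverse x y i & fps_comp s i = - s
        & exists2 c, integral c &
            x + const c =
            - deriv_omega x y (deriv_omega x y (of_fps s) / of_fps s)]].

End Sigma.

Section PadicSigma.
Context (p : nat) (Qp : completion (padic_val p)).

Definition is_padic_sigma (W : weierstrass Qp) (s : fps Qp) : Prop :=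
  is_sigma W (fun a => (0 <= cval Qp a)%E) s.

Definition fps_eval (s : fps Qp) (t : Qp) : Qp :=
  val_lim (cval Qp) (fun n => \sum_(k < n) s k * t ^+ k).

End PadicSigma.

Section NumberField.
Context (K : fieldExtType rat).

(* K = Q(sqrt q) for a negative rational number q. *)
Definition imaginary_quadratic : Prop :=
  \dim {: K} = 2%N /\ exists x : K, exists2 q : rat, q < 0 & x ^+ 2 = q%:A.

Definition OK : set K := [set x | integralOver (fun n : int => n%:~R : K) x].

Definition principal_ideal (a : K) : set K :=
  [set x | exists2 r, OK r & x = a * r].

Definition fractional_ideal (I : set K) : Prop :=
  [/\ forall x y, I x -> I y -> I (x + y),
      forall r x, OK r -> I x -> I (r * x),
      I 0, exists2 x, I x & x != 0
    & exists d, [/\ OK d, d != 0 & forall x, I x -> OK (d * x)]].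

Definition class_number_one : Prop :=
  forall I, fractional_ideal I -> exists a, I = principal_ideal a.

Definition ideal_mul (I J : set K) : set K :=
  [set x | exists n (a b : 'I_n -> K),
    [/\ forall i, I (a i), forall i, J (b i) & x = \sum_(i < n) a i * b i]].

(* A finite place, given by its normalized valuation. *)
Record finite_place := FinitePlace {
  place_val :> K -> \bar int;
  place_valP : valuation place_val;
  place_val_normalized : exists x, place_val x = 1%:E
}.

HB.instance Definition _ := gen_eqMixin finite_place.
HB.instance Definition _ := gen_choiceMixin finite_place.

Definition prime_ideal (v : finite_place) : set K :=
  [set x | OK x /\ (0 < v x)%E].

Definition splits (p : nat) (p1 p2 : finite_place) : Prop :=
  p1 <> p2 /\
  principal_ideal p%:R = ideal_mul (prime_ideal p1) (prime_ideal p2).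

(* Ideals of O_K are coprime when they are comaximal. *)
Definition OK_coprime (a b : K) : Prop :=
  exists u v, [/\ OK u, OK v & u * a + v * b = 1].

Section Reduction.
Context (v : finite_place).

Definition v_integral_model (W : weierstrass K) : Prop :=
  [/\ (0 <= v (wa1 W))%E, (0 <= v (wa2 W))%E, (0 <= v (wa3 W))%E,
      (0 <= v (wa4 W))%E & (0 <= v (wa6 W))%E].

Definition minimal_at (W : weierstrass K) : Prop :=
  v_integral_model W /\
  forall u r s t, u != 0 ->
    v_integral_model (change_of_variables W u r s t) ->
    (v (discriminant W) <= v (discriminant (change_of_variables W u r s t)))%E.

(* Homogeneous coordinates of P that are v-integral and not all divisible by v;
   they represent the reduction of P. *)
Definition primitive_coordinates (P : point K) (X Y Z : K) : Prop :=
  (exists2 l, l != 0 &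
     match P with
     | Infinity => [/\ X = 0, Y = l & Z = 0]
     | Affine x y => [/\ X = l * x, Y = l * y & Z = l]
     end) /\
  [/\ (0 <= v X)%E, (0 <= v Y)%E, (0 <= v Z)%E
    & [\/ v X = 0%E, v Y = 0%E | v Z = 0%E]].

(* P reduces to the point at infinity (0 : 1 : 0). *)
Definition in_kernel_of_reduction (P : point K) : Prop :=
  exists X Y Z,
    [/\ primitive_coordinates P X Y Z, (0 < v X)%E & (0 < v Z)%E].

(* The partial derivatives of the homogeneous equation
   Y^2 Z + a1 X Y Z + a3 Y Z^2 - X^3 - a2 X^2 Z - a4 X Z^2 - a6 Z^3
   do not all vanish at the reduction of P. *)
Definition nonsingular_reduction (W : weierstrass K) (P : point K) : Prop :=
  let: Weierstrass a1 a2 a3 a4 a6 := W in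
  exists X Y Z, primitive_coordinates P X Y Z /\
    [\/ v (a1 * Y * Z - 3 * X ^+ 2 - 2 * a2 * X * Z - a4 * Z ^+ 2) = 0%E,
        v (2 * Y * Z + a1 * X * Z + a3 * Z ^+ 2) = 0%E
      | v (Y ^+ 2 + a1 * X * Y + 2 * a3 * Y * Z - a2 * X ^+ 2
           - 2 * a4 * X * Z - 3 * a6 * Z ^+ 2) = 0%E].

(* For W minimal at v. *)
Definition good_reduction (W : weierstrass K) : Prop :=
  v (discriminant W) = 0%E.

(* r restricts to a ring morphism from the valuation ring to k whose kernel is
   the maximal ideal; this makes k an extension of the residue field of v. *)
Definition residue_map (k : fieldType) (r : K -> k) : Prop :=
  [/\ r 1 = 1,
      forall x y, (0 <= v x)%E -> (0 <= v y)%E -> r (x + y) = r x + r y,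
      forall x y, (0 <= v x)%E -> (0 <= v y)%E -> r (x * y) = r x * r y
    & forall x, (0 <= v x)%E -> (r x = 0 <-> (0 < v x)%E)].

(* The reduction of W has a nontrivial geometric p-torsion point, where p is
   the residue characteristic. *)
Definition ordinary_reduction (p : nat) (W : weierstrass K) : Prop :=
  exists (k : closedFieldType) (r : K -> k), residue_map r /\
    exists Q, [/\ on_curve (map_weierstrass r W) Q, Q <> Infinity
                & ec_mul (map_weierstrass r W) p Q = Infinity].

End Reduction.

Definition global_minimal (W : weierstrass K) : Prop :=
  [/\ OK (wa1 W), OK (wa2 W), OK (wa3 W), OK (wa4 W) & OK (wa6 W)] /\
  forall v, minimal_at v W.

Definition E_ht (p : nat) (W : weierstrass K) : set (point K) :=
  [set P | [/\ on_curve W P, non_torsion W P,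
      forall v : finite_place, (0 < v p%:R)%E -> in_kernel_of_reduction v P
    & forall v : finite_place, v p%:R = 0%E -> nonsingular_reduction v W P]].

Definition is_denominator (P : point K) (d : K) : Prop :=
  if P is Affine x y then
    exists a b,
      [/\ [/\ OK a, OK b, OK d & d != 0],
          [/\ OK_coprime a b, OK_coprime a d & OK_coprime b d],
          x = a / d ^+ 2 & y = b / d ^+ 3]
  else False.

(* d(P), well defined up to a unit of O_K. *)
Definition denominator (P : point K) : K := xget 1 [set d | is_denominator P d].

Definition t_param (P : point K) : K :=
  if P is Affine x y then - x / y else 0.

Section Ideles.
Context (R : realType) (Kv : forall v : finite_place, completion v).

(* Ideles of an imaginary quadratic field, which has one archimedean place, with
   completion R[i]. *)
Record idele := Idele {
  finite_part : forall v, Kv v;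
  infinite_part : R[i];
  finite_part_neq0 : forall v, finite_part v != 0;
  infinite_part_neq0 : infinite_part != 0;
  finite_part_units :
    finite_set [set v | cval (Kv v) (finite_part v) <> 0%E]
}.

Section LocalIdele.
Context (v : finite_place) (x : Kv v).

Let f : forall w, Kv w :=
  dfwith (fun w : finite_place => 1 : Kv w) (if x == 0 then 1 else x).

Fact local_idele_neq0 w : f w != 0.
Proof.
rewrite /f; have [<-|vw] := eqVneq v w.
  by rewrite dfwith_in; case: ifPn => // _; exact: oner_neq0.
by rewrite dfwith_out // oner_neq0.
Qed.

Fact local_idele_units : finite_set [set w | cval (Kv w) (f w) <> 0%E].
Proof.
apply: (sub_finite_set _ (finite_set1 v)) => w /= fw.
apply: contrapT => vw; apply: fw.
rewrite /f dfwith_out; first exact: valuation1 (cvalP _).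
by apply/eqP => e; apply: vw.
Qed.

(* The image of x under K_v^* -> A_K^*; the junk input x = 0 is sent to 1. *)
Definition local_idele : idele :=
  @Idele f 1 local_idele_neq0 (oner_neq0 _) local_idele_units.

End LocalIdele.

(* The restriction chi_v of chi to K_v^*. *)
Definition local_component (T : Type) (chi : idele -> T) (v : finite_place)
  (x : Kv v) : T := chi (local_idele x).

Context (p : nat) (Qp : completion (padic_val p)).

(* The isomorphism K_v -> Q_p induced by an embedding psi of K; its existence
   means that v is the place of K defined by psi. *)
Record induced_iso (psi : {rmorphism K -> Qp}) (v : finite_place) := InducedIso {
  iso_fun :> {rmorphism Kv v -> Qp};
  iso_inv : Qp -> Kv v;
  iso_funK : cancel iso_fun iso_inv;
  iso_invK : cancel iso_inv iso_fun;
  iso_embed : forall a, iso_fun (cembed (Kv v) a) = psi a;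
  iso_val : forall x, cval Qp (iso_fun x) = cval (Kv v) x
}.

Context (log : Qp -> Qp) (psi1 psi2 : {rmorphism K -> Qp})
  (p1 p2 : finite_place)
  (iso1 : induced_iso psi1 p1) (iso2 : induced_iso psi2 p2).

Definition chi_anti (x : idele) : Qp :=
  let alpha := xget 1 [set a : K | a != 0 /\ forall v,
      cval (Kv v) (cembed (Kv v) a * finite_part x v) = 0%E] in
  log (psi1 alpha * iso1 (finite_part x p1))
  - log (psi2 alpha * iso2 (finite_part x p2)).

Context (pi : forall v, Kv v) (sigma1 sigma2 : fps Qp) (P : point K).

Definition h_anti_local (v : finite_place) : Qp :=
  if v == p1 then
    local_component chi_anti
      (iso_inv iso1 (fps_eval sigma1 (psi1 (t_param P))))
  else if v == p2 then
    local_component chi_anti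
      (iso_inv iso2 (fps_eval sigma2 (psi2 (t_param P))))
  else
    local_component chi_anti (pi v ^ fine (v (denominator P))).

Definition h_anti : Qp := \sum_(v \in [set: finite_place]) h_anti_local v.

End Ideles.

End NumberField.

(* Main.v *)
Require Import Defs.
From HB Require Import structures.
From mathcomp Require Import all_boot all_order all_algebra all_field.
From mathcomp Require Import boolp classical_sets functions cardinality fsbigop.
From mathcomp Require Import reals constructive_ereal.
From mathcomp Require Import zify ring.

(** Fix a finite place v. The local height h_v(P) is the value of chi on the
    idele which is some z_v (a sigma value or a power of the uniformiser) at v
    and 1 elsewhere. Since O_K is principal, there is alpha_v in K^* with
    v(alpha_v) = - v(z_v) and w(alpha_v) = 0 for w <> v, and then
      h_v(P) = log psi_1(alpha_v) - log psi_2(alpha_v)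
               + [v = p_1] log sigma_1(t_1) - [v = p_2] log sigma_2(t_2).
    The key point is that v(z_v) = v(d) at every place. For v not above p this
    holds by definition of z_v, as two denominators of P have the same valuations
    (denominator_ord_unique). At p_i, the series sigma_i has integral
    coefficients and begins with t, so the term t_i dominates and sigma_i(t_i)
    has the valuation of t (fps_eval_val); and t = - a d / b, where a and b are
    units at p_i because P reduces to the point at infinity (kernel_t_ord).

    Only finitely many places contribute. Summing over them, the product A of
    the alpha_v satisfies v(A d) = 0 at all finite places, so A d is a unit of
    O_K, hence a root of unity because K is imaginary quadratic. As log is a
    homomorphism to a torsion-free group, it kills psi_i(A d), so that
    log psi_i(A) = - log psi_i(d), which is the formula.

    The arithmetic of O_K behind this is elementary. Conjugation provides the
    norm and the units (OK_norm_exists, OK_unit_root). Principality gives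
    greatest common divisors, so every element of K is a fraction a / b with
    u a + w b = 1; this makes the prime ideal of a place maximal and generated by
    an element that is a unit at all other places (uniformizer). Conversely every
    irreducible element defines a place (irreducible_valP), so an element with
    trivial valuations is a unit (ord_eq0_unit_root), and an element of O_K has
    finitely many zeros (OK_finite_support). *)

Set Implicit Arguments.
Unset Strict Implicit.
Unset Printing Implicit Defensive.

Import Order.TTheory GRing.Theory Num.Theory.

Local Open Scope ring_scope.

(** * Valuations *)

Section Valuation.
Context (F : fieldType) (v : F -> \bar int) (vP : valuation v).

Definition ord (x : F) : int := fine (v x).

Lemma val_ord x : x != 0 -> v x = (ord x)%:E.
Proof.
case: vP => v0 vN _ _ x0; rewrite /ord.
by case E: (v x) => [n| |] //=; [case/eqP: x0; apply/v0 | case: (vN x)].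
Qed.

Lemma val_0 : v 0 = +oo%E.
Proof. by case: vP => v0 _ _ _; apply/v0. Qed.

Lemma val_fin_neq0 x n : v x = n%:E -> x != 0.
Proof. by move=> E; apply/eqP => x0; move: E; rewrite x0 val_0. Qed.

Lemma ord_M x y : x != 0 -> y != 0 -> ord (x * y) = ord x + ord y.
Proof.
case: (vP) => _ _ vM _ x0 y0; rewrite {1}/ord vM !val_ord //.
Qed.

Lemma ord_1 : ord 1 = 0.
Proof. by rewrite /ord valuation1. Qed.

Lemma ord_V x : ord x^-1 = - ord x.
Proof.
have [->|x0] := eqVneq x 0; first by rewrite invr0 /ord val_0 oppr0.
have := @ord_M x^-1 x; rewrite mulVf // ord_1 invr_eq0 => /(_ x0 x0) /eqP.
by rewrite eq_sym addr_eq0 => /eqP.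
Qed.

Lemma ord_div x y : x != 0 -> y != 0 -> ord (x / y) = ord x - ord y.
Proof. by move=> x0 y0; rewrite ord_M ?invr_eq0 // ord_V. Qed.

Lemma ord_X x n : x != 0 -> ord (x ^+ n) = ord x *+ n.
Proof.
move=> x0; elim: n => [|n IH]; first by rewrite ord_1.
by rewrite exprS ord_M ?expf_neq0 // IH mulrS.
Qed.

Lemma ord_Xz x (n : int) : x != 0 -> ord (x ^ n) = ord x * n.
Proof.
move=> x0; case: n => n.
  by rewrite -[x ^ _]/(x ^+ n) ord_X // -[Posz n]natz mulr_natr.
rewrite NegzE -exprnN ord_V ord_X //.
by rewrite mulrN -[in RHS]natz mulr_natr.
Qed.

Lemma val_geD N x y : (N <= v x -> N <= v y -> N <= v (x + y)%R)%E.
Proof.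
case: vP => _ _ _ vD Nx Ny; apply: le_trans (vD x y).
by rewrite le_min Nx Ny.
Qed.

Lemma val_gtD N x y : (N < v x -> N < v y -> N < v (x + y)%R)%E.
Proof.
case: vP => _ _ _ vD Nx Ny; apply: lt_le_trans (vD x y).
by rewrite lt_min Nx Ny.
Qed.

Lemma val_N x : v (- x) = v x.
Proof.
have [->|x0] := eqVneq x 0; first by rewrite oppr0.
rewrite !val_ord ?oppr_eq0 //; congr (_%:E).
have N1 : (-1 : F) != 0 by rewrite oppr_eq0 oner_eq0.
rewrite -mulN1r ord_M //.
have : ord (-1) + ord (-1) = 0 by rewrite -ord_M // mulrNN mulr1 ord_1.
lia.
Qed.

Lemma val_geB N x y : (N <= v x -> N <= v y -> N <= v (x - y)%R)%E.
Proof. by move=> Nx Ny; apply: val_geD; rewrite ?val_N. Qed.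

Lemma val_ge0_1 : (0 <= v 1)%E.
Proof. by rewrite valuation1. Qed.

Lemma val_ge0_nat n : (0 <= v n%:R)%E.
Proof.
elim: n => [|n IH]; first by rewrite val_0 leey.
by rewrite mulrS val_geD ?val_ge0_1.
Qed.

Lemma val_ge0_int (n : int) : (0 <= v n%:~R)%E.
Proof. by case: n => n; rewrite ?NegzE ?mulrNz ?val_N; exact: val_ge0_nat. Qed.

Lemma val_gt_sum N (I : Type) (r : seq I) (P : pred I) (f : I -> F) :
  (N < +oo -> (forall i, P i -> N < v (f i)) ->
  N < v (\sum_(i <- r | P i) f i)%R)%E.
Proof.
move=> N0 H; elim/big_ind : _ => [|x y|//]; first by rewrite val_0.
exact: val_gtD.
Qed.

(** The dominant term alone decides the valuation, since subtracting the other
    one back would otherwise raise the valuation of x. *)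
Lemma val_dominant x y : (v x < v y -> v (x + y)%R = v x)%E.
Proof.
move=> xy; apply/eqP; rewrite eq_le; apply/andP; split; last first.
  by rewrite val_geD // ltW.
rewrite leNgt; apply/negP => lt; have := val_gtD lt.
move/(_ (- y)); rewrite val_N addrK => /(_ xy).
by rewrite ltxx.
Qed.

(** In an integral equation for x of negative valuation, the leading term would
    dominate all the others. *)
Lemma val_integral_ge0 x :
  integralOver (fun n : int => n%:~R : F) x -> (0 <= v x)%E.
Proof.
case=> q qm; rewrite rootE => /eqP q0.
have [->|x0] := eqVneq x 0; first by rewrite val_0 leey.
rewrite leNgt; apply/negP => xneg.
have {}xneg : ord x < 0 by rewrite -lte_fin -val_ord.
have sq : (size q = (size q).-1.+1)%N.
  by rewrite prednK // size_poly_gt0 monic_neq0.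
set m := (size q).-1 in sq.
have : v (x ^+ m + \sum_(i < m) (q`_i)%:~R * x ^+ i) = v (x ^+ m).
  apply: val_dominant; apply: val_gt_sum => [|[i im] _ /=].
    by rewrite val_ord ?expf_neq0 // ltry.
  have [->|q0'] := eqVneq ((q`_i)%:~R : F) 0.
    by rewrite mul0r val_0 val_ord ?expf_neq0 // ltry.
  rewrite !val_ord ?mulf_neq0 ?expf_neq0 // lte_fin ord_M ?expf_neq0 //.
  rewrite !ord_X //.
  have : ord x *+ (m - i) < 0 by rewrite pmulrn_llt0 ?subn_gt0.
  rewrite mulrnBr 1?ltnW // subr_lt0 => lt; rewrite ltr_wpDl //.
  by rewrite -lee_fin -val_ord ?val_ge0_int.
suff -> : x ^+ m + \sum_(i < m) (q`_i)%:~R * x ^+ i = 0.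
  by rewrite val_0 val_ord ?expf_neq0.
rewrite -[RHS]q0 (@horner_coef_wide _ m.+1) -?sq; last first.
  by rewrite /map_poly size_poly.
rewrite sq big_ord_recr /= [RHS]addrC; congr (_ + _); last first.
  by apply: eq_bigr => i _; rewrite coef_map_id0.
by rewrite coef_map_id0 // -[q`_m]/(lead_coef q) (monicP qm) mul1r.
Qed.

End Valuation.

(** * Integers of an imaginary quadratic field *)

Section IntegersRing.
Context (K : fieldExtType rat).
Implicit Types x y u : K.

Lemma OK_int (n : int) : OK (n%:~R : K).
Proof. exact: (@integral_id _ K (intr : {rmorphism int -> K})). Qed.

Lemma OK_0 : OK (0 : K). Proof. exact: (OK_int 0). Qed.

Lemma OK_1 : OK (1 : K). Proof. exact: (OK_int 1). Qed.

Lemma OK_D x y : OK x -> OK y -> OK (x + y).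
Proof. exact: (@integral_add _ _ (intr : {rmorphism int -> K})). Qed.

Lemma OK_M x y : OK x -> OK y -> OK (x * y).
Proof. exact: (@integral_mul _ _ (intr : {rmorphism int -> K})). Qed.

Lemma OK_N x : OK x -> OK (- x).
Proof. exact: (@integral_opp _ _ (intr : {rmorphism int -> K})). Qed.

Lemma OK_X x n : OK x -> OK (x ^+ n).
Proof.
move=> xO; elim: n => [|n IH]; first exact: OK_1.
by rewrite exprS; apply: OK_M.
Qed.

(** The rationals embed in the algebraic numbers, where rational algebraic integers
    are known to be integers. *)
Lemma rat_integral_int (c : rat) :
  integralOver (fun n : int => n%:~R : rat) c -> exists n : int, c = n%:~R.
Proof.
case=> q qm q0; suff: (ratr c : algC) \is a Num.int.
  case/intrP => n /eqP; rewrite -[n%:~R]ratr_int fmorph_eq /= => /eqP ->.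
  by exists n.
apply: Cint_rat_Aint; first exact: Crat_rat.
apply: (@root_monic_Aint (map_poly intr q)).
- have -> : map_poly intr q = map_poly (ratr : rat -> algC) (map_poly intr q).
    by rewrite -map_poly_comp; apply: eq_map_poly => n /=; rewrite ratr_int.
  by rewrite fmorph_root.
- exact: monic_map.
- by apply/polyOverP => i; rewrite coef_map /= intr_int.
Qed.

Lemma OK_rat_int (c : rat) : OK (c%:A : K) -> exists n : int, c = n%:~R.
Proof.
case=> q qm q0; apply: rat_integral_int; exists q => //.
have E : map_poly (intr : int -> K) q = map_poly (in_alg K) (map_poly intr q).
  rewrite -map_poly_comp; apply: eq_map_poly => n /=.
  by rewrite scaler_int.
by move: q0; rewrite E fmorph_root.
Qed.

End IntegersRing.

Section ImaginaryQuadratic.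
Context (K : fieldExtType rat) (hK : imaginary_quadratic K).
Implicit Types x y u : K.

(** In the last clause 2 a is the trace and n the norm of x. The inequality holds
    since n - a ^ 2 is - q times a square when K = Q(sqrt q), and q < 0. *)
Definition conjugation (c : K -> K) : Prop :=
  [/\ c 1 = 1, forall x y, c (x * y) = c x * c y,
      forall x, OK x -> OK (c x)
    & forall x, exists a n : rat,
      [/\ x + c x = (2 * a)%:A, x * c x = n%:A & a ^+ 2 <= n]].

Lemma conjugation_exists : exists c, conjugation c.
Proof.
case: hK => dimK [s [q q0]].
have [i iE] : exists i : {rmorphism rat -> K}, forall a, a%:A = i a.
  by exists (in_alg K).
rewrite iE => s2.
have sNQ b : s != i b.
  apply/eqP => sb; move: s2; rewrite sb -rmorphXn => /(@fmorph_inj _ _ i) /eqP.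
  by rewrite eq_sym lt_eqF // (lt_le_trans q0) ?sqr_ge0.
have indep a b : i a + i b * s = 0 -> b = 0.
  move=> E; apply/eqP; apply: contraT => b0.
  have /eqP[] := sNQ (- (a / b)).
  have bA : i b != 0 by rewrite fmorph_eq0.
  apply: (mulfI bA); rewrite -rmorphM /= mulrN mulrCA divff // mulr1 rmorphN /=.
  by apply/eqP; rewrite -addr_eq0 addrC E.
have coords x : exists ab : rat * rat, x == i ab.1 + i ab.2 * s.
  have fr : free [:: 1; s].
    rewrite free_cons seq1_free span_seq1; apply/andP; split; last first.
      by apply/eqP => s0; have := sNQ 0; rewrite s0 rmorph0 eqxx.
    apply/vlineP => -[b E]; have b0 : b != 0.
      by apply/eqP => b0; move/eqP: E; rewrite b0 scale0r oner_eq0.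
    by have := sNQ b^-1; rewrite -iE E scalerA mulVf // scale1r eqxx.
  (* Both have dimension 2. *)
  have full : span [:: 1; s] = fullv.
    apply/eqP; rewrite -(dimv_leqif_eq (subvf _)).2 dimK.
    by move: fr; rewrite /free => /eqP ->.
  have : x \in span [:: 1; s] by rewrite full memvf.
  rewrite span_cons span_seq1 => /memv_addP[_ /vlineP[a ->] [_ /vlineP[b ->] ->]].
  by exists (a, b) => /=; rewrite -!iE mulr_algl.
pose f x := xchoose (coords x).
have fE x : x = i (f x).1 + i (f x).2 * s := eqP (xchooseP (coords x)).
pose c x := i (f x).1 - i (f x).2 * s.
have f_eq x a b : x = i a + i b * s -> c x = i a - i b * s.
  move=> E; have b0 : (f x).2 - b = 0.
    apply: (indep ((f x).1 - a)); rewrite !rmorphB /= mulrBl.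
    by apply/eqP; rewrite addrACA -opprD -E -fE subrr.
  move/subr0_eq: b0 => b0; rewrite /c b0; congr (_ - _).
  by apply: (addIr (i b * s)); rewrite -E -b0 -fE.
exists c; split.
- by rewrite (@f_eq 1 1 0) !rmorph0 rmorph1 mul0r ?subr0 ?addr0.
- move=> x y.
  rewrite (@f_eq (x * y) ((f x).1 * (f y).1 + (f x).2 * (f y).2 * q)
    ((f x).1 * (f y).2 + (f x).2 * (f y).1)); last first.
    rewrite {1}(fE x) {1}(fE y) !rmorphD /= !rmorphM /= -s2.
    by ring.
  by rewrite /c !rmorphD /= !rmorphM /= -s2; ring.
- move=> x [P Pm]; rewrite rootE => /eqP P0; exists P => //.
  (* Evaluating P commutes with conjugation, as P has rational coefficients. *)
  have [ab [E1 E2]] : exists ab : rat * rat,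
      (map_poly (intr : int -> K) P).[x] = i ab.1 + i ab.2 * s /\
      (map_poly (intr : int -> K) P).[c x] = i ab.1 - i ab.2 * s.
    elim/poly_ind: P {Pm P0} => [|P n [[a b] /= [E1 E2]]].
      by exists (0, 0); rewrite /= rmorph0 !horner0 rmorph0 mul0r addr0 subr0.
    exists (a * (f x).1 + b * (f x).2 * q + n%:~R, a * (f x).2 + b * (f x).1).
    rewrite /= !rmorphD /= !rmorphM /= map_polyX map_polyC /= !hornerE E1 E2.
    rewrite {1}(fE x) /c -s2 rmorph_int.
    by split; ring.
  move: E1; rewrite P0 => /esym E1; have b0 := indep _ _ E1.
  by move: E1 E2; rewrite b0 rmorph0 mul0r addr0 subr0 rootE => -> ->.
- move=> x; exists (f x).1, ((f x).1 ^+ 2 - q * (f x).2 ^+ 2); rewrite !iE; split.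
  + by rewrite {1}(fE x) /c rmorphM /= rmorph_nat; ring.
  + rewrite {1}(fE x) /c !(rmorphB, rmorphXn, rmorphM) /= -s2.
    by ring.
  + by rewrite lerDl oppr_ge0 mulr_le0_ge0 ?sqr_ge0 // ltW.
Qed.

Lemma OK_trace_norm c x : conjugation c -> OK x ->
  exists (T : int) (M : nat),
    [/\ x + c x = T%:~R, x * c x = M%:R & T ^+ 2 <= 4 * M%:Z].
Proof.
case=> _ _ cO cTN xO; have [a [n [Ea En an]]] := cTN x.
have [T ET] : exists T : int, 2 * a = T%:~R.
  by apply: (@OK_rat_int K); rewrite -Ea; apply: OK_D => //; apply: cO.
have [M EM] : exists M : int, n = M%:~R.
  by apply: (@OK_rat_int K); rewrite -En; apply: OK_M => //; apply: cO.
have le : T ^+ 2 <= 4 * M.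
  rewrite -(ler_int rat) rmorphXn rmorphM /= -ET -EM.
  by rewrite exprMn -natrX ler_pM2l.
have M0 : 0 <= M.
  by rewrite -(pmulr_rge0 _ (isT : 0 < 4 :> int)) (le_trans (sqr_ge0 T)).
exists T, `|M|%N; split; last by rewrite gez0_abs.
  by rewrite Ea ET scaler_int.
by rewrite En EM scaler_int pmulrn gez0_abs.
Qed.

Lemma natK_inj : injective (fun n : nat => n%:R : K).
Proof.
move=> m n E; apply/eqP; rewrite -(eqr_nat rat); apply/eqP.
by apply: (fmorph_inj (in_alg K)); rewrite !rmorph_nat.
Qed.

(** The absolute norm: the integral case of x c(x). A norm equal to 1 makes c(x)
    the inverse of x. *)
Lemma OK_norm_exists : exists N : K -> nat,
  [/\ forall x y, OK x -> OK y -> N (x * y) = (N x * N y)%N,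
      forall x, OK x -> x != 0 -> (0 < N x)%N
    & forall x, OK x -> N x = 1%N -> OK x^-1].
Proof.
have [c cc] := conjugation_exists; have [_ cM cO cTN] := cc.
have exN x : exists M : nat, OK x -> x * c x = M%:R.
  have [xO|xO] := pselect (OK x); last by exists 0%N.
  by have [T [M [_ E _]]] := OK_trace_norm cc xO; exists M.
pose N x := projT1 (cid (exN x)).
have NE x : OK x -> x * c x = (N x)%:R.
  by move=> xO; exact: (projT2 (cid (exN x)) xO).
exists N; split.
- move=> x y xO yO; apply: natK_inj; rewrite -NE; last exact: OK_M.
  by rewrite natrM -!NE // cM mulrACA.
- move=> x xO x0; rewrite lt0n; apply/eqP => N0.
  have := NE x xO; rewrite N0 => /eqP; rewrite mulf_eq0 (negPf x0) /= => /eqP c0.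
  have [a [n [Ea En an]]] := cTN x.
  move: Ea En; rewrite c0 mulr0 addr0 => Ea /esym /eqP.
  rewrite scaler_eq0 oner_eq0 orbF => /eqP n0; move: an; rewrite n0 => an.
  have a0 : a = 0 by apply/eqP; rewrite -sqrf_eq0 eq_le an sqr_ge0.
  by move: x0; rewrite Ea a0 mulr0 scale0r eqxx.
- move=> x xO N1; suff -> : x^-1 = c x by exact: cO.
  have E : x * c x = 1 by rewrite NE // N1.
  have x0 : x != 0 by apply/eqP => x0; move/eqP: E; rewrite x0 mul0r eq_sym oner_eq0.
  by apply: (mulfI x0); rewrite E divff.
Qed.

(** A unit u has norm 1, so it is a root of X^2 - T X + 1 with an integer T such
    that T^2 <= 4; it is then a root of unity of order 1, 2, 3, 4 or 6. *)
Lemma OK_unit_root u : u != 0 -> OK u -> OK u^-1 -> u ^+ 12 = 1.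
Proof.
move=> u0 uO uVO; have [c cc] := conjugation_exists; have [c1 cM _ _] := cc.
have [T [M [ET EM TM]]] := OK_trace_norm cc uO.
have [T' [M' [_ EM' _]]] := OK_trace_norm cc uVO.
have M1 : M = 1%N.
  have : M%:R * M'%:R = 1 :> K by rewrite -EM -EM' mulrACA -cM divff // c1 mulr1.
  by rewrite -natrM => /(@natK_inj _ 1%N)/eqP; rewrite muln_eq1 => /andP[/eqP].
(* The conjugate of u is T - u. *)
have cu : u * (T%:~R - u) = 1 by rewrite -ET addrC addKr EM M1.
have [T0 T3] : -3 < T /\ T < 3 by move: TM; rewrite M1; split; nia.
have E2 : u ^+ 2 = T%:~R * u - 1 by rewrite -[X in _ - X]cu; ring.
(* For T = 1 or T = -1 the polynomial divides X^3 + T. *)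
have cube (e : K) : u ^+ 2 = e * u - 1 -> e ^+ 2 = 1 -> u ^+ 3 = - e.
  move=> E e2; rewrite exprS E mulrBr mulrCA -expr2 E.
  by rewrite mulrBr mulrA -expr2 e2; ring.
have : T = -2 \/ T = -1 \/ T = 0 \/ T = 1 \/ T = 2 by lia.
case=> [|[|[|[]]]] ET'; rewrite ET' in E2.
- suff -> : u = -1 by rewrite -signr_odd.
  apply/eqP; rewrite -addr_eq0 -sqrf_eq0; apply/eqP.
  by rewrite sqrrD E2; ring.
- rewrite -[12%N]/(3 * 4)%N exprM (cube (-1)) ?sqrrN ?expr1n //.
  by rewrite opprK expr1n.
- by rewrite -[12%N]/(2 * 6)%N exprM E2 mul0r sub0r -signr_odd.
- rewrite -[12%N]/(3 * 4)%N exprM (cube 1) ?expr1n //.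
  by rewrite -signr_odd.
- suff -> : u = 1 by rewrite expr1n.
  apply/eqP; rewrite -subr_eq0 -sqrf_eq0; apply/eqP.
  by rewrite sqrrB E2; ring.
Qed.

Lemma OK_frac x : exists a b, [/\ OK a, OK b, b != 0 & x = a / b].
Proof.
have [c [_ _ _ /(_ x)[a [n [Ea En _]]]]] := conjugation_exists.
(* D clears the denominators of the trace and the norm, so that D x is integral. *)
pose D : int := denq (2 * a) * denq n.
have D0 : (D%:~R : K) != 0.
  by rewrite -scaler_int scaler_eq0 oner_eq0 orbF intr_eq0 mulf_neq0 ?denq_neq0.
have multiple (r : rat) (k : int) : exists m : int, (k * denq r)%:~R * r = m%:~R.
  by exists (k * numq r); rewrite !rmorphM /= numqE -mulrA [_%:~R * r]mulrC.
have [T ET] := multiple (2 * a) (denq n).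
have [M EM] := multiple n (denq (2 * a)).
rewrite [denq n * _]mulrC -/D in ET; rewrite -/D in EM.
clearbody D.
exists (D%:~R * x), D%:~R; split=> //; last 1 first.
- by rewrite [D%:~R * x]mulrC mulfK.
- exists (('X - T%:P) * 'X + (D * M)%:P).
    rewrite monicE lead_coefDl; first by rewrite lead_coefMX -monicE monicXsubC.
    rewrite size_mulX ?monic_neq0 ?monicXsubC // size_XsubC.
    by rewrite (leq_ltn_trans (size_polyC_leq1 _)).
  have E : D%:~R * (x + c x) = T%:~R /\ D%:~R * (x * c x) = M%:~R.
    by rewrite Ea En -!scaler_int !mulr_algl !scalerA ET EM.
  rewrite rootE !(rmorphD, rmorphM, rmorphN) /= map_polyX !map_polyC !hornerE /=.
  rewrite -E.1 -E.2; apply/eqP.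
  by ring.
- exact: OK_int.
Qed.

End ImaginaryQuadratic.

(** * Finite places of an imaginary quadratic field of class number one *)

(** Divisibility is well founded: removing a factor that is not a unit makes the
    absolute norm smaller. *)
Lemma OK_factor_ind (K : fieldExtType rat) (hK : imaginary_quadratic K)
    (P : K -> Prop) :
  (forall a, OK a -> a != 0 ->
     (forall b c, OK b -> OK c -> ~ OK c^-1 -> a = b * c -> P b) -> P a) ->
  forall a, OK a -> a != 0 -> P a.
Proof.
move=> step; have [N [NM N0 N1]] := OK_norm_exists hK.
move=> a; have [n] := ubnP (N a); elim: n a => // n IH a Na aO a0.
apply: step => // b c bO cO cU E.
have [b0 c0] : b != 0 /\ c != 0.
  by apply/andP; move: a0; rewrite E mulf_eq0 negb_or.
apply: IH => //; apply: leq_trans (Na : (N a <= n)%N).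
rewrite E NM // ltn_Pmulr ?N0 // ltn_neqAle eq_sym N0 // andbT.
by apply/eqP => /(N1 _ cO).
Qed.

Section PrincipalIdeals.
Context (K : fieldExtType rat) (hK : imaginary_quadratic K).
Context (hcl : class_number_one K).
Implicit Types (a b x u : K) (v w : finite_place K).

(** The ideal generated by a and b is principal; its generator g divides both and
    is a combination of both. *)
Lemma OK_gcd a b : OK a -> OK b -> b != 0 ->
  exists g a' b', [/\ OK a', OK b', a = g * a', b = g * b' & OK_coprime a' b'].
Proof.
move=> aO bO b0.
pose I : set K :=
  [set z | exists u w : K, [/\ OK u, OK w & z = u * a + w * b]]%classic.
have Ia : I a.
  by exists 1, 0; split; [exact: OK_1|exact: OK_0|rewrite mul1r mul0r addr0].
have Ib : I b.
  by exists 0, 1; split; [exact: OK_0|exact: OK_1|rewrite mul1r mul0r add0r].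
have [g Ig] : exists g, I = principal_ideal g.
  apply: hcl; split.
  - move=> _ _ [u1 [w1 [u1O w1O ->]]] [u2 [w2 [u2O w2O ->]]].
    exists (u1 + u2), (w1 + w2); split; [exact: OK_D|exact: OK_D|by ring].
  - move=> r _ rO [u [w [uO wO ->]]].
    by exists (r * u), (r * w); split; [exact: OK_M|exact: OK_M|ring].
  - by exists 0, 0; split; [exact: OK_0|exact: OK_0|ring].
  - by exists b.
  - exists 1; split; [exact: OK_1|exact: oner_neq0|].
    move=> _ [u [w [uO wO ->]]]; rewrite mul1r.
    by apply: OK_D; exact: OK_M.
have [a' a'O Ea] : principal_ideal g a by rewrite -Ig.
have [b' b'O Eb] : principal_ideal g b by rewrite -Ig.
have [u [w [uO wO Eg]]] : I g.
  by rewrite Ig; exists 1; [exact: OK_1|rewrite mulr1].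
exists g, a', b'; split=> //; exists u, w; split=> //.
have g0 : g != 0 by apply: contraNneq b0; rewrite Eb => ->; rewrite mul0r.
apply: (mulfI g0); rewrite mulr1 [RHS]Eg Ea Eb.
by rewrite -[X in X = _](_ : u * (g * a') + w * (g * b') = _) //; ring.
Qed.

Lemma coprime_frac x :
  exists a b, [/\ OK a, OK b, b != 0, OK_coprime a b & x = a / b].
Proof.
have [a [b [aO bO b0 ->]]] := OK_frac hK x.
have [g [a' [b' [a'O b'O Ea Eb cop]]]] := OK_gcd aO bO b0.
have [g0 b'0] : g != 0 /\ b' != 0.
  by apply/andP; move: b0; rewrite Eb mulf_eq0 negb_or.
by exists a', b'; split=> //; rewrite Ea Eb -mulf_div divff ?mul1r.
Qed.

Lemma place_ge0 v x : OK x -> (0 <= v x)%E.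
Proof. exact: val_integral_ge0 (place_valP v) _. Qed.

Lemma place_ord v x : x != 0 -> v x = (ord v x)%:E.
Proof. exact: val_ord (place_valP v) _. Qed.

Lemma place_ord_ge0 v x : OK x -> 0 <= ord v x.
Proof.
move=> xO; have := place_ge0 v xO; rewrite /ord.
by case: (v x) => //= n; rewrite lee_fin.
Qed.

(** A combination of a and b equal to 1 would have positive valuation. *)
Lemma coprime_place v a b : OK_coprime a b -> (0 < v a)%E -> (0 < v b)%E -> False.
Proof.
have [_ _ vM _] := place_valP v.
case=> r [s [rO sO E]] va vb.
have := val_gtD (place_valP v) (N := 0%E) (x := r * a) (y := s * b).
rewrite E (valuation1 (place_valP v)) ltxx !vM => H.
suff: false by []; apply: H.
  by rewrite (lt_le_trans va) // leeDr ?place_ge0.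
by rewrite (lt_le_trans vb) // leeDr ?place_ge0.
Qed.

Lemma place_ord_eq0 v x : x != 0 -> OK x -> ~ (0 < v x)%E -> ord v x = 0.
Proof.
move=> x0 xO; rewrite place_ord // lte_fin => /negP; rewrite -leNgt => le.
by apply/eqP; rewrite eq_le le place_ord_ge0.
Qed.

Lemma place_ord_gt0 v x : x != 0 -> 0 < ord v x -> (0 < v x)%E.
Proof. by move=> x0; rewrite place_ord ?lte_fin. Qed.

Lemma coprime_frac_ord v a b : a != 0 -> b != 0 -> OK a -> OK b ->
  OK_coprime a b -> ord v a = 0 \/ ord v b = 0.
Proof.
move=> a0 b0 aO bO cop; have [va|va] := pselect (0 < v a)%E; last first.
  by left; apply: place_ord_eq0.
by right; apply: place_ord_eq0 => // vb; exact: coprime_place cop va vb.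
Qed.

(** The elements of valuation 1 already occur in the ring of integers, as numerators
    of coprime fractions, so the generator of the prime ideal has valuation 1. *)
Lemma prime_ideal_principal v : exists pi,
  [/\ OK pi, pi != 0, ord v pi = 1
    & forall a, OK a -> (0 < v a)%E -> principal_ideal pi a].
Proof.
have vP := place_valP v; have [_ _ vM _] := vP.
have [x vx] := place_val_normalized v.
have [a [b [aO bO b0 cop Ex]]] := coprime_frac x.
have x0 : x != 0 := val_fin_neq0 vP vx.
have a0 : a != 0 by apply: contraNneq x0; rewrite Ex => ->; rewrite mul0r.
have {vx} vx : ord v x = 1 by rewrite /ord vx.
have va : ord v a = 1.
  move: vx; rewrite Ex ord_div //.
  have := place_ord_ge0 v aO; have := place_ord_ge0 v bO.
  by case: (coprime_frac_ord v a0 b0 aO bO cop) => ->; lia.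
have va_gt0 : (0 < v a)%E by rewrite place_ord // va lte_fin.
have [pi Epi] : exists pi, prime_ideal v = principal_ideal pi.
  apply: hcl; split.
  - move=> y z [yO vy] [zO vz]; split; first exact: OK_D.
    exact: val_gtD.
  - move=> r y rO [yO vy]; split; first exact: OK_M.
    by rewrite vM (lt_le_trans vy) // leeDr ?place_ge0.
  - by split; [exact: OK_0|rewrite val_0].
  - by exists a.
  - exists 1; split; [exact: OK_1|exact: oner_neq0|].
    by move=> y [yO _]; rewrite mul1r.
have [piO vpi] : prime_ideal v pi.
  by rewrite Epi; exists 1; [exact: OK_1|rewrite mulr1].
have dvd y : OK y -> (0 < v y)%E -> principal_ideal pi y by rewrite -Epi.
have [r rO Ea] := dvd a aO va_gt0.
have [pi0 r0] : pi != 0 /\ r != 0.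
  by apply/andP; move: a0; rewrite Ea mulf_eq0 negb_or.
exists pi; split=> //.
move: va vpi; rewrite Ea ord_M // place_ord // lte_fin.
by have := place_ord_ge0 v rO; lia.
Qed.

(** The prime ideal of v is maximal, so a place w that is positive on a generator
    of it vanishes wherever v does, and is then a multiple of v. *)
Lemma uniformizer v : exists pi,
  [/\ OK pi, pi != 0, ord v pi = 1,
      forall w, w <> v -> ord w pi = 0
    & forall a, OK a -> (0 < v a)%E -> principal_ideal pi a].
Proof.
have [pi [piO pi0 vpi dvd]] := prime_ideal_principal v.
exists pi; split=> // w wv; apply: place_ord_eq0 => // wpi; apply: wv.
have vP := place_valP v; have wP := place_valP w.
have unitO a : OK a -> a != 0 -> ord v a = 0 -> ord w a = 0.
  move=> aO a0 va.
  (* The greatest common divisor g of a and pi is a unit, since pi divides pi / g. *)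
  have [g [a' [h [a'O hO Ea Eh [r [s [rO sO E]]]]]]] := OK_gcd aO piO pi0.
  have [g0 a'0] : g != 0 /\ a' != 0.
    by apply/andP; move: a0; rewrite Ea mulf_eq0 negb_or.
  have h0 : h != 0 by apply: contraNneq pi0; rewrite Eh => ->; rewrite mulr0.
  have vh : (0 < v h)%E.
    move: va vpi; rewrite Ea Eh place_ord // lte_fin !ord_M //.
    by have := place_ord_ge0 v a'O; have := place_ord_ge0 v hO; lia.
  have [k kO Ek] := dvd h hO vh.
  have gk : g * k = 1 by apply: (mulfI pi0); rewrite mulr1 [RHS]Eh Ek mulrCA.
  have cop : OK_coprime a pi.
    exists (r * k), (s * k); split; [exact: OK_M|exact: OK_M|].
    by rewrite -E Ea Ek -[r in RHS]mulr1 -gk; ring.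
  by apply: place_ord_eq0 => // wa; exact: coprime_place cop wa wpi.
have unit x : x != 0 -> ord v x = 0 -> ord w x = 0.
  move=> x0; have [a [b [aO bO b0 cop Ex]]] := coprime_frac x.
  have a0 : a != 0 by apply: contraNneq x0; rewrite Ex => ->; rewrite mul0r.
  rewrite Ex !ord_div // => E.
  have [va|vb] := coprime_frac_ord v a0 b0 aO bO cop.
    by rewrite !unitO //; lia.
  by rewrite !unitO //; lia.
have scale x : x != 0 -> ord w x = ord v x * ord w pi.
  move=> x0; have := unit (x / pi ^ ord v x).
  have p0 : pi ^ ord v x != 0 by rewrite expfz_eq0 (negPf pi0) andbF.
  rewrite !ord_div // !ord_Xz // vpi mul1r subrr mulf_neq0 ?invr_eq0 //.
  by move=> /(_ isT erefl) /eqP; rewrite subr_eq0 => /eqP ->; rewrite mulrC.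
(* w is normalized, so the factor of proportionality divides 1. *)
have wpi1 : ord w pi = 1.
  have [x wx] := place_val_normalized w.
  have x0 : x != 0 := val_fin_neq0 wP wx.
  have : ord w x = 1 by rewrite /ord wx.
  rewrite place_ord // lte_fin in wpi.
  rewrite scale // => E1; have : (ord w pi %| 1)%Z.
    by apply/dvdzP; exists (ord v x); rewrite E1.
  by rewrite dvdz1; lia.
have E : place_val w = place_val v.
  apply/funext => x; have [->|x0] := eqVneq x 0; first by rewrite !val_0.
  by rewrite !place_ord // scale // wpi1 mulr1.
case: w v E {wpi wP unitO unit scale wpi1 vpi dvd vP} => w w1 w2 [v v1 v2] /= E.
by case: _ / E v1 v2 => v1 v2; congr FinitePlace; exact: Prop_irrelevance.
Qed.

End PrincipalIdeals.

(** * Places and units *)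

Section PlacesOfPrimes.
Context (K : fieldExtType rat) (hK : imaginary_quadratic K).
Context (hcl : class_number_one K).
Implicit Types (a b x y u : K) (v w : finite_place K).

Definition OK_irreducible (q : K) : Prop :=
  [/\ OK q, q != 0, ~ OK q^-1
    & forall a b, OK a -> OK b -> q = a * b -> OK a^-1 \/ OK b^-1].

Lemma irreducible_factor a : OK a -> a != 0 -> ~ OK a^-1 ->
  exists2 q, OK_irreducible q & principal_ideal q a.
Proof.
move: a; apply: (OK_factor_ind hK) => a aO a0 IH aU.
have [irr|red] := pselect (OK_irreducible a).
  by exists a => //; exists 1; [exact: OK_1|rewrite mulr1].
have [b [c [bO cO E bU cU]]] :
    exists b c, [/\ OK b, OK c, a = b * c, ~ OK b^-1 & ~ OK c^-1].
  apply: contrapT => no; apply: red; split=> // b c bO cO E.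
  have [bU|bU] := pselect (OK b^-1); first by left.
  have [cU|cU] := pselect (OK c^-1); first by right.
  by case: no; exists b, c.
have [q irr [r rO Er]] := IH b c bO cO cU E bU.
exists q => //; exists (r * c); first exact: OK_M.
by rewrite E Er mulrA.
Qed.

Section IrreducibleElement.
Context (q : K) (irr : OK_irreducible q).
Let qO : OK q. Proof. by case: irr. Qed.
Let q0 : q != 0. Proof. by case: irr. Qed.

(** Let g be the greatest common divisor of a and q. Either g is q up to a unit, and
    q divides a; or g is a unit, and multiplying the combination of a and q that
    equals g by b / g writes b as a combination of a b and q. *)
Lemma irreducible_prime a b : OK a -> OK b ->
  principal_ideal q (a * b) -> principal_ideal q a \/ principal_ideal q b.
Proof.
case: irr => _ _ _ irrq aO bO [r rO E].
have [g [a' [h [a'O hO Ea Eh [s [t [sO tO st]]]]]]] := OK_gcd hcl aO qO q0.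
have gO : OK g.
  rewrite (_ : g = s * a + t * q); last by rewrite -[LHS]mulr1 -st Ea Eh; ring.
  by apply: OK_D; exact: OK_M.
have [g0 h0] : g != 0 /\ h != 0.
  by apply/andP; move: q0; rewrite Eh mulf_eq0 negb_or.
have [gU|hU] := irrq g h gO hO Eh; last first.
  left; exists (h^-1 * a'); first exact: OK_M.
  by rewrite Eh Ea -mulrA mulVKf.
right; exists (g^-1 * (s * r + t * b)).
  by apply: OK_M => //; apply: OK_D; apply: OK_M.
apply: (mulfI g0); rewrite mulrCA [g * (_ * _)]mulVKf // mulrDr.
rewrite [q * (s * r)]mulrCA -E.
by rewrite Ea Eh -[LHS]mul1r -st; ring.
Qed.

Lemma irreducible_ndiv1 : ~ principal_ideal q 1.
Proof.
case: irr => _ _ qU _ [r rO E]; apply: qU.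
by rewrite -[q^-1]mulr1 E mulKf.
Qed.

Lemma ndiv_neq0 a : ~ principal_ideal q a -> a != 0.
Proof.
by move=> H; apply/eqP => a0; apply: H; exists 0; [exact: OK_0|rewrite mulr0].
Qed.

Lemma ndiv_M a b : OK a -> OK b ->
  ~ principal_ideal q a -> ~ principal_ideal q b -> ~ principal_ideal q (a * b).
Proof. by move=> aO bO qa qb /(irreducible_prime aO bO)[]. Qed.

Lemma irreducible_decomp a : OK a -> a != 0 ->
  exists k b, [/\ OK b, ~ principal_ideal q b & a = q ^+ k * b].
Proof.
move: a; apply: (OK_factor_ind hK) => a aO a0 IH.
have [[r rO E]|nd] := pselect (principal_ideal q a); last first.
  by exists 0%N, a; rewrite mul1r.
have qU : ~ OK q^-1 by case: irr.
have [k [b [bO nb Er]]] := IH r q rO qO qU (etrans E (mulrC _ _)).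
by exists k.+1, b; rewrite E Er mulrA exprS.
Qed.

(** The q-adic valuation of x is n, as a relation. *)
Definition exponent x (n : int) : Prop :=
  exists a b, [/\ OK a /\ OK b, ~ principal_ideal q a, ~ principal_ideal q b
    & x = q ^ n * (a / b)].

Lemma exponent_exists x : x != 0 -> exists n, exponent x n.
Proof.
move=> x0; have [a [b [aO bO b0 E]]] := OK_frac hK x.
have a0 : a != 0 by apply: contraNneq x0; rewrite E => ->; rewrite mul0r.
have [k [a' [a'O na Ea]]] := irreducible_decomp aO a0.
have [m [b' [b'O nb Eb]]] := irreducible_decomp bO b0.
exists (k%:Z - m%:Z), a', b'; split=> //.
by rewrite E Ea Eb -mulf_div expfzDr // exprnP exprnN.
Qed.

Lemma exponent_unique x n m : exponent x n -> exponent x m -> n = m.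
Proof.
wlog nm : n m / n <= m.
  move=> H En Em; have [nm|/ltW mn] := leP n m; first exact: H nm En Em.
  exact: esym (H _ _ mn Em En).
move=> [a [b [[aO bO] na nb ->]]] [c [e [[cO eO] nc ne E]]].
apply/eqP; rewrite eq_le nm /= leNgt; apply/negP => lt.
apply: (ndiv_M aO eO na ne).
have [j Em] : exists j : nat, m = n + 1 + j%:Z by exists (absz (m - n - 1)%R); lia.
have b0 := ndiv_neq0 nb; have e0 := ndiv_neq0 ne.
exists (q ^+ j * c * b); first by do !apply: OK_M => //; exact: OK_X.
have qn : q ^ n != 0 by rewrite expfz_eq0 (negPf q0) andbF.
apply: (mulfI qn).
have -> : a * e = a / b * (b * e) by field.
rewrite [LHS]mulrA E Em !expfzDr // -exprnP expr1z.
by field.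
Qed.

Lemma exponent_M x y n m : exponent x n -> exponent y m -> exponent (x * y) (n + m).
Proof.
move=> [a [b [[aO bO] na nb ->]]] [c [e [[cO eO] nc ne ->]]].
exists (a * c), (b * e); split; [by split; exact: OK_M|exact: ndiv_M|exact: ndiv_M|].
by rewrite expfzDr // -mulf_div mulrACA.
Qed.

Lemma exponent_D x y n m : n <= m -> exponent x n -> exponent y m ->
  x + y != 0 -> exists2 k, n <= k & exponent (x + y) k.
Proof.
move=> nm [a [b [[aO bO] na nb ->]]] [c [e [[cO eO] nc ne ->]]].
have [b0 e0] := (ndiv_neq0 nb, ndiv_neq0 ne).
have [j ->] : exists j : nat, m = n + j%:Z by exists (absz (m - n)%R); lia.
rewrite expfzDr // -exprnP.
pose z := a * e + q ^+ j * c * b.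
have zO : OK z by apply: OK_D; do !apply: OK_M => //; exact: OK_X.
have -> : q ^ n * (a / b) + q ^ n * q ^+ j * (c / e) = q ^ n * (z / (b * e)).
  by rewrite /z; field; rewrite b0 e0.
rewrite !mulf_eq0 !negb_or => /andP[_ /andP[z0 _]].
have [k [t [tO nt ->]]] := irreducible_decomp zO z0.
exists (n + k%:Z); first by lia.
exists t, (b * e); split=> //; [by split=> //; exact: OK_M|exact: ndiv_M|].
by rewrite expfzDr // -exprnP !mulrA.
Qed.

Definition irreducible_val x : \bar int :=
  if x == 0 then +oo%E else (xget 0 [set n | exponent x n]%classic)%:E.

Lemma irreducible_valE x n : exponent x n -> irreducible_val x = n%:E.
Proof.
move=> xn; rewrite /irreducible_val ifN; last first.
  have [a [b [_ na nb ->]]] := xn.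
  by rewrite !mulf_neq0 ?invr_eq0 ?expfz_eq0 ?(negPf q0) ?andbF ?ndiv_neq0.
congr (_%:E); apply: (exponent_unique _ xn).
by apply: xgetPex; exists n.
Qed.

Lemma irreducible_valP : valuation irreducible_val.
Proof.
have ival x : x != 0 -> exists2 n, exponent x n & irreducible_val x = n%:E.
  by move=> /exponent_exists[n xn]; exists n => //; exact: irreducible_valE.
have val0 : irreducible_val 0 = +oo%E by rewrite /irreducible_val eqxx.
split.
- by move=> x; split=> [|->//]; have [//|/ival[n _ ->]] := eqVneq x 0.
- by move=> x; have [->|/ival[n _ ->]] := eqVneq x 0; rewrite ?val0.
- move=> x y; have [->|/ival[n xn Ex]] := eqVneq x 0.
    rewrite mul0r val0; have [->|/ival[m _ ->]] := eqVneq y 0; by rewrite ?val0.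
  have [->|/ival[m ym Ey]] := eqVneq y 0; first by rewrite mulr0 val0 Ex.
  by rewrite (irreducible_valE (exponent_M xn ym)) Ex Ey.
- move=> x y; have [->|/ival[n xn Ex]] := eqVneq x 0.
    by rewrite add0r ge_min lexx orbT.
  have [->|/ival[m ym Ey]] := eqVneq y 0; first by rewrite addr0 ge_min lexx.
  have [->|xy0] := eqVneq (x + y) 0; first by rewrite val0 leey.
  rewrite ge_min Ex Ey; have [nm|/ltW mn] := leP n m.
    have [k nk xyk] := exponent_D nm xn ym xy0.
    by rewrite (irreducible_valE xyk) lee_fin nk.
  rewrite addrC in xy0 *; have [k nk xyk] := exponent_D mn ym xn xy0.
  by rewrite (irreducible_valE xyk) !lee_fin nk orbT.
Qed.

Lemma irreducible_val1 : irreducible_val q = 1%:E.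
Proof.
apply: irreducible_valE; exists 1, 1.
split; [split; exact: OK_1|exact: irreducible_ndiv1|exact: irreducible_ndiv1|].
by rewrite divr1 mulr1 expr1z.
Qed.

End IrreducibleElement.

(** An irreducible factor provides the place. *)
Lemma nonunit_place a : OK a -> a != 0 -> ~ OK a^-1 -> exists v, 0 < ord v a.
Proof.
move=> aO a0 aU; have [q irr [r rO E]] := irreducible_factor aO a0 aU.
pose v := FinitePlace (irreducible_valP irr) (ex_intro _ q (irreducible_val1 irr)).
exists v; have [q0 r0] : q != 0 /\ r != 0.
  by apply/andP; move: a0; rewrite E mulf_eq0 negb_or.
have vq : ord v q = 1 by rewrite /ord [v q](irreducible_val1 irr).
by rewrite E (ord_M (place_valP v)) // vq ltr_pwDl ?place_ord_ge0.
Qed.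

Lemma OK_unit_ord v u : OK u -> OK u^-1 -> ord v u = 0.
Proof.
move=> /(place_ord_ge0 v) u_ge0 /(place_ord_ge0 v).
by rewrite (ord_V (place_valP v)); lia.
Qed.

(** Dividing by a uniformizer of a place v that is positive on a affects no place but
    v, and terminates. *)
Lemma OK_finite_support a : OK a -> a != 0 ->
  exists s : seq (finite_place K), forall v, v \notin s -> ord v a = 0.
Proof.
move: a; apply: (OK_factor_ind hK) => a aO a0 IH.
have [aU|aU] := pselect (OK a^-1).
  by exists [::] => v _; exact: OK_unit_ord.
have [v va] := nonunit_place aO a0 aU.
have [pi [piO pi0 vpi piw dvd]] := uniformizer hK hcl v.
have [r rO E] := dvd a aO (place_ord_gt0 a0 va).
have r0 : r != 0 by apply: contraNneq a0; rewrite E => ->; rewrite mulr0.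
have piU : ~ OK pi^-1 by move=> piU; move: vpi; rewrite OK_unit_ord.
have [s Hs] := IH r pi rO piO piU (etrans E (mulrC _ _)).
exists (v :: s) => w; rewrite inE negb_or => /andP[/eqP wv ws].
by rewrite E (ord_M (place_valP w)) // piw // Hs.
Qed.

(** In a coprime fraction a / b without zeros and poles, a place that is positive on
    b would vanish on a and make a pole, so b is a unit. *)
Lemma ord_eq0_unit_root u : u != 0 -> (forall v, ord v u = 0) -> u ^+ 12 = 1.
Proof.
have integral x : x != 0 -> (forall v, ord v x = 0) -> OK x.
  move=> x0 xv; have [a [b [aO bO b0 cop E]]] := coprime_frac hK hcl x.
  have a0 : a != 0 by apply: contraNneq x0; rewrite E => ->; rewrite mul0r.
  rewrite E; apply: OK_M => //; apply: contrapT => bU.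
  have [v vb] := nonunit_place bO b0 bU.
  have := xv v; rewrite E (ord_div (place_valP v)) //.
  by case: (coprime_frac_ord v a0 b0 aO bO cop); lia.
move=> u0 uv; apply: OK_unit_root => //; apply: integral => //.
  by rewrite invr_eq0.
by move=> v; rewrite (ord_V (place_valP v)) uv.
Qed.

(** The elements needed to turn a local idele into an idele that is a unit at every
    finite place. *)
Lemma place_element v (n : int) : exists al,
  [/\ al != 0, ord v al = n & forall w, w <> v -> ord w al = 0].
Proof.
have [pi [_ pi0 vpi piw _]] := uniformizer hK hcl v.
exists (pi ^ n); split.
- by rewrite expfz_eq0 (negPf pi0) andbF.
- by rewrite (ord_Xz (place_valP v)) // vpi mul1r.
- by move=> w wv; rewrite (ord_Xz (place_valP w)) // piw // mul0r.
Qed.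

End PlacesOfPrimes.

(** * Evaluation of the sigma function *)

(** The term of degree one dominates all others, and their sum. *)
Lemma fps_eval_val (p : nat) (Qp : completion (padic_val p)) (s : fps Qp) (t : Qp) :
  (forall n, 0 <= cval Qp (s n))%E -> s 0%N = 0 -> s 1%N = 1 ->
  t != 0 -> (0 < cval Qp t)%E -> cval Qp (fps_eval s t) = cval Qp t.
Proof.
move=> s_int s0 s1 t0 t_gt0; have wP := cvalP Qp.
set w := cval Qp in s_int t_gt0 wP *.
have {}t_gt0 : 0 < ord w t by rewrite -lte_fin -val_ord.
pose u n := \sum_(k < n) s k * t ^+ k.
have term k : ((ord w t *+ k)%R%:E <= w (s k * t ^+ k)%R)%E.
  have [->|sk0] := eqVneq (s k) 0; first by rewrite mul0r val_0 ?leey.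
  rewrite val_ord ?mulf_neq0 ?expf_neq0 // lee_fin ord_M ?expf_neq0 // ord_X //.
  by rewrite lerDr -lee_fin -val_ord.
(* The sum from degree m on has valuation at least m times that of t. *)
have tail m j : ((ord w t *+ m)%R%:E <= w (u (m + j)%N - u m)%R)%E.
  elim: j => [|j IH]; first by rewrite addn0 subrr val_0 ?leey.
  rewrite addnS /u big_ord_recr /= addrAC; apply: val_geD => //.
  apply: le_trans (term _); rewrite lee_fin mulrnDr lerDl.
  by rewrite mulrn_wge0 // ltW.
have u_cauchy : val_cauchy w u.
  move=> N; exists (absz N) => m n.
  wlog mn : m n / (m <= n)%N.
    move=> H Nm Nn; have [mn|/ltnW nm] := leqP m n; first exact: H.
    by rewrite -opprB val_N //; exact: H.
  move=> Nm _; rewrite -opprB val_N // -(subnKC mn).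
  apply: le_trans (tail m _); rewrite lee_fin.
  have : m%:Z <= ord w t *+ m by rewrite -mulr_natr natz ler_peMl; lia.
  by apply: le_trans; lia.
have u_cvg : val_cvg w u (fps_eval s t).
  by apply: xgetPex; exact: cval_complete u_cauchy.
(* The limit is t plus the tail from degree 2 on, up to a small error. *)
have [n0 /(_ (2 + n0)%N (leq_addl _ _)) near] := u_cvg (ord w t + 1).
have -> : fps_eval s t =
    t + ((u (2 + n0)%N - u 2%N) - (u (2 + n0)%N - fps_eval s t)).
  rewrite {2}/u !big_ord_recr big_ord0 /= s0 s1 mul0r mul1r expr1 !add0r.
  by ring.
apply: val_dominant => //.
have tE : (w t < (ord w t + 1)%:E)%E by rewrite val_ord // lte_fin ltrDl.
apply: lt_le_trans tE _; apply: val_geB => //.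
apply: le_trans (tail 2%N n0); rewrite lee_fin mulr2n lerD2l.
by rewrite -gtz0_ge1.
Qed.

(** * Denominators *)

Section Denominators.
Context (K : fieldExtType rat).
Implicit Types (x y d : K) (v : finite_place K).

(** Coprimality of a and d means that no pole of x = a / d ^ 2 cancels, so the
    valuation of d can be read off from x. *)
Lemma denominator_pole v x y d : is_denominator (Affine x y) d ->
  (ord v d = 0 /\ (0 <= v x)%E) \/
  [/\ 0 < ord v d, x != 0 & ord v x = - (ord v d *+ 2)].
Proof.
move=> [a [b [[aO bO dO d0] [_ ad _] Ex _]]]; have vP := place_valP v.
have [vd|vd] := pselect (0 < v d)%E; last first.
  left; have od := place_ord_eq0 d0 dO vd; split=> //.
  have [a0|a0] := eqVneq a 0; first by rewrite Ex a0 mul0r val_0 ?leey.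
  rewrite Ex place_ord ?mulf_neq0 ?invr_eq0 ?expf_neq0 // lee_fin.
  by rewrite ord_div ?expf_neq0 // ord_X // od mul0rn subr0 place_ord_ge0.
have va : ~ (0 < v a)%E by move=> va; exact: coprime_place ad va vd.
have a0 : a != 0 by apply/eqP => a0; apply: va; rewrite a0 val_0.
right; split.
- by move: vd; rewrite place_ord // lte_fin.
- by rewrite Ex mulf_neq0 ?invr_eq0 ?expf_neq0.
by rewrite Ex ord_div ?expf_neq0 // ord_X // place_ord_eq0 // sub0r.
Qed.

Lemma denominator_ord_unique v x y d d' :
  is_denominator (Affine x y) d -> is_denominator (Affine x y) d' ->
  ord v d = ord v d'.
Proof.
move=> /(denominator_pole v) D /(denominator_pole v) D'.
case: D => [[-> vx]|[d_gt0 x0 vx]]; case: D' => [[-> vx']|[d'_gt0 x0' vx']] //.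
- by move: vx; rewrite place_ord // lee_fin vx'; lia.
- by move: vx'; rewrite place_ord // lee_fin vx; lia.
- by move: vx'; rewrite vx; lia.
Qed.

(** At a pole of y the numerators a and b of x and y are units, so that
    t = - a d / b has the valuation of d. *)
Lemma kernel_t_ord v x y d :
  in_kernel_of_reduction v (Affine x y) -> is_denominator (Affine x y) d ->
  - x / y != 0 /\ v (- x / y) = (ord v d)%:E /\ 0 < ord v d.
Proof.
move=> [_ [_ [_ [[[l l0 [-> -> ->]] [_ _ _ prim]] vX vZ]]]].
move=> [a [b [[aO bO dO d0] [_ ad bd] Ex Ey]]]; have vP := place_valP v.
have vY : v (l * y) = 0%E by case: prim => // E; [move: vX|move: vZ]; rewrite E ltxx.
have y0 : y != 0 by apply: contraPneq vY => ->; rewrite mulr0 val_0.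
have b0 : b != 0 by apply: contraNneq y0; rewrite Ey => ->; rewrite mul0r.
have vd : 0 < ord v d.
  move: vZ vY; rewrite !place_ord ?mulf_neq0 // lte_fin ord_M // => l_gt0 [].
  rewrite Ey ord_div ?expf_neq0 // ord_X //.
  by have := place_ord_ge0 v bO; lia.
have vd' : (0 < v d)%E := place_ord_gt0 d0 vd.
have va : ~ (0 < v a)%E by move=> va; exact: coprime_place ad va vd'.
have vb : ~ (0 < v b)%E by move=> vb; exact: coprime_place bd vb vd'.
have a0 : a != 0 by apply/eqP => a0; apply: va; rewrite a0 val_0.
have E : - x / y = - (a * d / b).
  by rewrite Ex Ey; field; rewrite d0 b0.
have t0 : a * d / b != 0 by rewrite !mulf_neq0 ?invr_eq0.
rewrite E oppr_eq0; split=> //; split=> //; rewrite (val_N vP) place_ord //.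
rewrite ord_div ?mulf_neq0 // ord_M // (place_ord_eq0 a0) // (place_ord_eq0 b0) //.
by rewrite add0r subr0.
Qed.

End Denominators.

(** * The anticyclotomic height *)

Section Logarithm.
Context (p : nat) (Qp : completion (padic_val p)) (log : Qp -> Qp).
Context (hlog : iwasawa_log log).
Implicit Types x y : Qp.

Lemma log_M x y : x != 0 -> y != 0 -> log (x * y) = log x + log y.
Proof. by case: hlog => logM _ _; exact: logM. Qed.

Lemma log_1 : log 1 = 0.
Proof.
have := log_M (oner_neq0 _) (oner_neq0 _); rewrite mulr1 => /eqP.
by rewrite -subr_eq0 opprD addNKr oppr_eq0 => /eqP.
Qed.

Lemma log_div x y : x != 0 -> y != 0 -> log (x / y) = log x - log y.
Proof.
move=> x0 y0; apply/eqP; rewrite eq_sym subr_eq.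
by rewrite -log_M ?mulf_neq0 ?invr_eq0 // divfK.
Qed.

Lemma log_unit_root x n : (0 < n)%N -> x ^+ n = 1 -> log x = 0.
Proof.
move=> n0 xn; have x0 : x != 0.
  by apply/eqP => x0; move/eqP: xn; rewrite x0 expr0n gtn_eqF // eq_sym oner_eq0.
have logX k : log (x ^+ k) = log x *+ k.
  elim: k => [|k IH]; first by rewrite log_1.
  by rewrite exprS log_M ?expf_neq0 // IH mulrS.
have := logX n; rewrite xn log_1 -mulr_natr => /esym /eqP; rewrite mulf_eq0.
case/orP => [/eqP//|].
by rewrite -(rmorph_nat (cembed Qp)) fmorph_eq0 pnatr_eq0 gtn_eqF.
Qed.

Lemma log_prod (I : eqType) (r : seq I) (f : I -> Qp) : (forall i, f i != 0) ->
  log (\prod_(i <- r) f i) = \sum_(i <- r) log (f i).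
Proof.
move=> f0; elim: r => [|i r IH]; first by rewrite !big_nil log_1.
by rewrite !big_cons log_M ?IH // prodf_seq_neq0; apply/allP => j _; exact: f0.
Qed.

End Logarithm.

Section LocalIdele.
Context (K : fieldExtType rat) (R : realType).
Context (Kv : forall v : finite_place K, completion v).

Lemma local_idele_in (v : finite_place K) (z : Kv v) : z != 0 ->
  finite_part (local_idele R z) v = z.
Proof. by move=> z0; rewrite /= dfwith_in ifN. Qed.

Lemma local_idele_out (v w : finite_place K) (z : Kv v) : v != w ->
  finite_part (local_idele R z) w = 1.
Proof. by move=> vw; rewrite /= dfwith_out. Qed.

End LocalIdele.

Section Height.
Context (R : realType).
Context (K : fieldExtType rat) (hK : imaginary_quadratic K).
Context (hcl : class_number_one K).
Context (Kv : forall v : finite_place K, completion v).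
Context (p : nat) (Qp : completion (padic_val p)).
Context (log : Qp -> Qp) (hlog : iwasawa_log log).
Context (p1 p2 : finite_place K) (p12 : p1 != p2).
Context (psi1 psi2 : {rmorphism K -> Qp}).
Context (iso1 : induced_iso Kv psi1 p1) (iso2 : induced_iso Kv psi2 p2).
Implicit Types (v w : finite_place K).

(** Whatever generator is chosen in the definition of the character, only its
    valuations matter. *)
Lemma chi_anti_local v (z : Kv v) n : cval (Kv v) z = n%:E ->
  exists al : K, [/\ al != 0, ord v al = - n, forall w, w != v -> ord w al = 0
    & local_component (chi_anti (R := R) log iso1 iso2) z =
      log (psi1 al * iso1 (finite_part (local_idele R z) p1))
      - log (psi2 al * iso2 (finite_part (local_idele R z) p2))].
Proof.
move=> zn; have z0 : z != 0 := val_fin_neq0 (cvalP (Kv v)) zn.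
have emb w a : a != 0 -> cval (Kv w) (cembed (Kv w) a) = (ord w a)%:E.
  by move=> a0; rewrite cval_embed place_ord.
set f := finite_part (local_idele R z).
pose A := [set a : K | a != 0 /\ forall w,
  cval (Kv w) (cembed (Kv w) a * f w) = 0%E]%classic.
have [] : A (xget 1 A).
  apply: xgetPex; have [a [a0 va wa]] := place_element hK hcl v (- n).
  exists a; split=> // w; case: (cvalP (Kv w)) => _ _ -> _; rewrite emb //.
  have [<-|vw] := eqVneq v w.
    by rewrite /f local_idele_in // zn va -EFinD addNr.
  rewrite /f local_idele_out // (valuation1 (cvalP _)) wa ?adde0 //.
  by apply/eqP; rewrite eq_sym.
set al := xget 1 A => al0 alf; exists al; split=> //.
- have := alf v; case: (cvalP (Kv v)) => _ _ -> _.
  rewrite emb // /f local_idele_in // zn -EFinD => -[] /eqP.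
  by rewrite addr_eq0 => /eqP.
- move=> w wv; have := alf w; case: (cvalP (Kv w)) => _ _ -> _.
  rewrite emb // /f local_idele_out 1?eq_sym // (valuation1 (cvalP _)) adde0.
  by case.
Qed.

Context (pi : forall v, Kv v) (hpi : forall v, cval (Kv v) (pi v) = 1%:E).
Context (sigma1 sigma2 : fps Qp) (P : Defs.point K) (d : K).
Context (dO : OK d) (d0 : d != 0) (hd : forall v, ord v (denominator P) = ord v d).
Let s1 := fps_eval sigma1 (psi1 (t_param P)).
Let s2 := fps_eval sigma2 (psi2 (t_param P)).
Context (hs1 : cval Qp s1 = (ord p1 d)%:E) (hs2 : cval Qp s2 = (ord p2 d)%:E).

Let s1_neq0 : s1 != 0. Proof. by have := val_fin_neq0 (cvalP Qp) hs1. Qed.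
Let s2_neq0 : s2 != 0. Proof. by have := val_fin_neq0 (cvalP Qp) hs2. Qed.

Lemma h_anti_local_value v : exists al : K,
  [/\ al != 0, ord v al = - ord v d, forall w, w != v -> ord w al = 0
    & h_anti_local R log iso1 iso2 pi sigma1 sigma2 P v =
      ((if v == p1 then log s1 else 0) - (if v == p2 then log s2 else 0))
      + (log (psi1 al) - log (psi2 al))].
Proof.
rewrite /h_anti_local; have [->|v1] := eqVneq v p1.
  have z1 : cval (Kv p1) (iso_inv iso1 s1) = (ord p1 d)%:E.
    by rewrite -(iso_val iso1) iso_invK.
  have z10 := val_fin_neq0 (cvalP _) z1.
  have [al [al0 val wal ->]] := chi_anti_local z1.
  exists al; split=> //; rewrite (negPf p12) subr0.
  rewrite local_idele_in // iso_invK local_idele_out // rmorph1 mulr1.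
  by rewrite (log_M hlog) ?fmorph_eq0 // [log (psi1 al) + _]addrC addrA.
have [->|v2] := eqVneq v p2.
  have z2 : cval (Kv p2) (iso_inv iso2 s2) = (ord p2 d)%:E.
    by rewrite -(iso_val iso2) iso_invK.
  have z20 := val_fin_neq0 (cvalP _) z2.
  have [al [al0 val wal ->]] := chi_anti_local z2.
  exists al; split=> //.
  rewrite local_idele_in // iso_invK local_idele_out 1?eq_sym // rmorph1 mulr1.
  by rewrite (log_M hlog) ?fmorph_eq0 //; ring.
have z : cval (Kv v) (pi v ^ fine (v (denominator P))) = (ord v d)%:E.
  have pi0 := val_fin_neq0 (cvalP _) (hpi v).
  rewrite (val_ord (cvalP _)) ?expfz_eq0 ?(negPf pi0) ?andbF //.
  rewrite (ord_Xz (cvalP _)) // /ord hpi /= mul1r.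
  by rewrite -[fine (v _)]/(ord v _) hd.
have [al [al0 val wal ->]] := chi_anti_local z.
exists al; split=> //.
by rewrite !local_idele_out // !rmorph1 !mulr1 subr0 add0r.
Qed.

(** Multiplying the generators of all places together leaves an element that is,
    up to a root of unity, the inverse of d. *)
Lemma h_anti_value :
  h_anti R log iso1 iso2 pi sigma1 sigma2 P =
  (log s1 - log s2) - (log (psi1 d) - log (psi2 d)).
Proof.
have [al alP] := choice h_anti_local_value.
have al0 v : al v != 0 by case: (alP v).
have [s0 Hs0] := OK_finite_support hK hcl dO d0.
(* Every place with a nonzero contribution is in s. *)
pose s := undup [:: p1, p2 & s0].
have s_uniq : uniq s := undup_uniq _.
have log_root (psi : {rmorphism K -> Qp}) u :
    u != 0 -> (forall v, ord v u = 0) -> log (psi u) = 0.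
  move=> u0 /(ord_eq0_unit_root hK hcl u0) u12.
  by apply: (log_unit_root hlog (n := 12)) => //; rewrite -rmorphXn u12 rmorph1.
have out v : v \notin s -> [/\ v != p1, v != p2 & ord v d = 0].
  rewrite mem_undup !inE !negb_or => /and3P[v1 v2 vs].
  by split=> //; exact: Hs0.
rewrite /h_anti (fsbigE s) //; last first.
  move=> v _ vs; have [v1 v2 vd] := out v vs.
  have [_ val wal ->] := alP v.
  have al_ord w : ord w (al v) = 0.
    by have [->|/wal//] := eqVneq w v; rewrite val vd oppr0.
  by rewrite (negPf v1) (negPf v2) !log_root // !subr0 addr0.
rewrite (eq_bigl xpredT) => [|v]; last by rewrite in_setT.
under eq_bigr => v _ do rewrite (let: And4 E1 E2 E3 E := alP v in E).
rewrite big_split /= !sumrB.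
have p1s : p1 \in s by rewrite mem_undup inE eqxx.
have p2s : p2 \in s by rewrite mem_undup !inE eqxx orbT.
have pick q (c : Qp) : q \in s -> \sum_(v <- s) (if v == q then c else 0) = c.
  move=> qs; rewrite (bigD1_seq q) //= eqxx big1 ?addr0 // => v /negPf -> //.
rewrite !pick //; congr (_ + _).
pose A := \prod_(v <- s) al v.
have A0 : A != 0 by rewrite prodf_seq_neq0; apply/allP => v _; exact: al0.
have Aord w : ord w A = - ord w d.
  have -> : ord w A = \sum_(v <- s) ord w (al v).
    rewrite /A; elim: (s) => [|v r IH].
      by rewrite !big_nil (ord_1 (place_valP w)).
    rewrite !big_cons (ord_M (place_valP w)) ?IH //.
    by rewrite prodf_seq_neq0; apply/allP => u _; exact: al0.
  have other v : w != v -> ord w (al v) = 0 by case: (alP v) => _ _ H _ /H.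
  have [ws|ws] := boolP (w \in s).
    rewrite (bigD1_seq w) //= big1 ?addr0 => [|v vw].
      by case: (alP w).
    by rewrite other // eq_sym.
  have [_ _ ->] := out w ws; rewrite oppr0 big1_seq // => v /= vs.
  by apply: other; apply: contraNneq ws => ->.
have logA (psi : {rmorphism K -> Qp}) :
    \sum_(v <- s) log (psi (al v)) = - log (psi d).
  rewrite -(log_prod hlog) => [|v]; last by rewrite fmorph_eq0.
  rewrite -rmorph_prod; apply/eqP; rewrite -addr_eq0 -(log_M hlog) ?fmorph_eq0 //.
  rewrite -rmorphM log_root ?mulf_neq0 // => v.
  by rewrite (ord_M (place_valP v)) // Aord addNr.
by rewrite !logA opprK opprB addrC.
Qed.

End Height.

Theorem proposition2p14
  (R : realType)
  (K : fieldExtType rat) (hK : imaginary_quadratic K) (hcl : class_number_one K)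
  (Kv : forall v : finite_place K, completion v)
  (W : weierstrass K) (hW : discriminant W != 0) (hmin : global_minimal W)
  (p : nat) (hp : prime p) (hodd : odd p)
  (Qp : completion (padic_val p))
  (log : Qp -> Qp) (hlog : iwasawa_log log)
  (p1 p2 : finite_place K) (hsplit : splits p p1 p2)
  (psi1 psi2 : {rmorphism K -> Qp})
  (iso1 : induced_iso Kv psi1 p1) (iso2 : induced_iso Kv psi2 p2)
  (hgood1 : good_reduction p1 W) (hord1 : ordinary_reduction p1 p W)
  (hgood2 : good_reduction p2 W) (hord2 : ordinary_reduction p2 p W)
  (sigma1 sigma2 : fps Qp)
  (hsigma1 : is_padic_sigma (map_weierstrass psi1 W) sigma1)
  (hsigma2 : is_padic_sigma (map_weierstrass psi2 W) sigma2)
  (pi : forall v, Kv v) (hpi : forall v, cval (Kv v) (pi v) = 1%:E)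
  (x y : K) (hP : E_ht p W (Affine x y))
  (d : K) (hd : is_denominator (Affine x y) d) :
  let t := - x / y in
  let t1 := psi1 t in
  let t2 := psi2 t in
  h_anti R log iso1 iso2 pi sigma1 sigma2 (Affine x y) =
  log (fps_eval sigma1 t1 / fps_eval sigma2 t2) - log (psi1 d / psi2 d).
Proof.
move=> t t1 t2.
have p12 : p1 != p2 by apply/eqP; case: hsplit.
have psi_val psi v (iso : induced_iso Kv psi v) a : cval Qp (psi a) = v a.
  by rewrite -(iso_embed iso) iso_val cval_embed.
have eval psi v (iso : induced_iso Kv psi v) sigma :
    is_padic_sigma (map_weierstrass psi W) sigma ->
    cval Qp (fps_eval sigma (psi t)) = (ord v d)%:E.
  case=> sint sg0 sg1 _.
  (* psi identifies v with a place above p. *)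
  have ker : in_kernel_of_reduction v (Affine x y).
    case: hP => _ _ + _; apply; rewrite -(psi_val _ _ iso) rmorph_nat.
    rewrite -(rmorph_nat (cembed Qp)) cval_embed.
    rewrite /padic_val pnatr_eq0 gtn_eqF ?prime_gt0 //.
    rewrite -[p%:R]/(p%:Z%:~R) numq_int denq_int /= logn1 subr0 lte_fin.
    by rewrite logn_prime ?eqxx.
  have [t0 [vt vd]] := kernel_t_ord ker hd.
  by rewrite fps_eval_val ?fmorph_eq0 // (psi_val _ _ iso) vt // lte_fin.
have s10 : fps_eval sigma1 t1 != 0.
  by have := val_fin_neq0 (cvalP Qp) (eval _ _ iso1 _ hsigma1).
have s20 : fps_eval sigma2 t2 != 0.
  by have := val_fin_neq0 (cvalP Qp) (eval _ _ iso2 _ hsigma2).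
have [_ [_ [[_ _ dO d0] _ _ _]]] := hd.
have hden (v : finite_place K) : ord v (denominator (Affine x y)) = ord v d.
  by apply: (denominator_ord_unique v _ hd); apply: (xgetPex 1); exists d.
rewrite (h_anti_value R hK hcl hlog p12 iso1 iso2 hpi dO d0 hden).
- by rewrite !(log_div hlog) ?fmorph_eq0.
- exact: eval iso1 _ hsigma1.
- exact: eval iso2 _ hsigma2.
Qed.
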